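(* Let $X$ be an infinite set, and let $\rho$ be the number of cardinals $\mu$ satisfying $\aleph_0\leq\mu\leq|X|$. (i) $\operatorname{rank}(\mathcal F_X^L:\mathcal F_X)=1+\rho$. (ii) If $\rho<\aleph_0$, and if $\Omega\subseteq\mathcal F_X^L$ with $|\Omega|=1+\rho$, then $\mathcal F_X^L=\langle\mathcal F_X\cup\Omega\rangle$ if and only if $\Omega$ can be written as $\Omega=\{\alpha_\mu : \mu=1\text{ or }\aleph_0\leq\mu\leq|X|\}$ (indexed by cardinals $\mu$), where for each $\mu$, $\operatorname{codef}(\alpha_\mu)<\mu=\operatorname{def}(\alpha_\mu)$.
   Context: Partial Brauer monoid. Let $X$ be a set and $X'=\{x':x\in X\}$ a disjoint copy of $X$. A Brauer graph is an (undirected) graph with vertex set $X\cup X'$ in which every vertex has degree at most $1$; $\mathcal{PB}_X$ is the set of all of them. Product: let $X''=\{x'':x\in X\}$ be another disjoint copy of $X$; given $\alpha,\beta\in\mathcal{PB}_X$, let $\alpha^\vee$ be $\alpha$ with each vertex $x'$ renamed $x''$, let $\beta^\wedge$ be $\beta$ with each vertex $x\in X$ renamed $x''$, and let $\Pi(\alpha,\beta)$ be the graph on $X\cup X'\cup X''$ with all edges of $\alpha^\vee$ and $\beta^\wedge$. Then $\alpha\beta$ is the graph on $X\cup X'$ with an edge $\{x,y\}$ whenever $x,y\in X\cup X'$ are distinct and lie in the same connected component of $\Pi(\alpha,\beta)$. This makes $\mathcal{PB}_X$ a monoid with identity the graph with edge set $\{\{x,x'\}:x\in X\}$. A transversal of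 $\alpha$ is an edge $\{x,y'\}$ with $x,y\in X$ (possibly $x=y$). $\operatorname{Dom}(\alpha)$ is the set of $x\in X$ such that $x$ belongs to a transversal of $\alpha$; $\operatorname{Codom}(\alpha)$ is the set of $x\in X$ such that $x'$ belongs to a transversal; $\operatorname{def}(\alpha)=|X\setminus\operatorname{Dom}(\alpha)|$ and $\operatorname{codef}(\alpha)=|X\setminus\operatorname{Codom}(\alpha)|$. In a monoid $M$, an element $x$ is a left unit if $ax=1$ for some $a\in M$, and a (two-sided) unit if also $xb=1$ for some $b\in M$. $\mathcal G_X^L$ and $\mathcal G_X$ denote the submonoids of all left units and of all units of $\mathcal{PB}_X$. $\mathcal F_X^L$ (respectively $\mathcal F_X$) denotes the subsemigroup of $\mathcal{PB}_X$ generated by all idempotents of $\mathcal{PB}_X$ together with $\mathcal G_X^L$ (respectively $\mathcal G_X$). For a subset $U$ of a semigroup $S$, $\langle U\rangle$ is the subsemigroup generated by $U$. For $A\subseteq S$, the relative rank is $\operatorname{rank}(S:A)=\min\{|U| : U\subseteq S,\ S=\langle A\cup U\rangle\}$. *)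

(* Defs.v *)
From HB Require Import structures.
From Stdlib Require Export Relation_Operators Operators_Properties.
From mathcomp Require Export all_boot.
From mathcomp Require Export boolp classical_sets functions cardinality.

Set Implicit Arguments.
Unset Strict Implicit.
Unset Printing Implicit Defensive.

Local Open Scope classical_set_scope.
Local Open Scope group_scope.

(* The vertex set X ∪ X' is X + X: inl x stands for x and inr x for x'. *)
Record brauer_graph (X : Type) := BrauerGraph {
  edge :> X + X -> X + X -> Prop;
  edge_irrefl : forall u, ~ edge u u;
  edge_sym : forall u v, edge u v -> edge v u;
  edge_uniq : forall u v w, edge u v -> edge u w -> v = w
}.

HB.instance Definition _ (X : Type) := gen_eqMixin (brauer_graph X).
HB.instance Definition _ (X : Type) := gen_choiceMixin (brauer_graph X).

Lemma brauer_graphP (X : Type) (a b : brauer_graph X) :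
  (forall u v, a u v <-> b u v) -> a = b.
Proof.
case: a b => [a a1 a2 a3] [b b1 b2 b3] /= ab.
have {}ab : a = b by apply/funext => u; apply/funext => v; apply/propext.
by subst b; congr BrauerGraph; apply: Prop_irrelevance.
Qed.

(* The vertex set X ∪ X' ∪ X''; middle x stands for x''. *)
Inductive vertex3 (X : Type) := upper of X | middle of X | lower of X.
Arguments upper {X}.
Arguments middle {X}.
Arguments lower {X}.

Definition ren_lower (X : Type) (u : X + X) : vertex3 X :=
  match u with inl x => upper x | inr x => middle x end.

Definition ren_upper (X : Type) (u : X + X) : vertex3 X :=
  match u with inl x => middle x | inr x => lower x end.

Definition outer (X : Type) (u : X + X) : vertex3 X :=
  match u with inl x => upper x | inr x => lower x end.

Definition image_graph (V W : Type) (f : V -> W) (e : V -> V -> Prop) :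
    W -> W -> Prop :=
  fun p q => exists u v, [/\ e u v, f u = p & f v = q].

Definition product_graph (X : Type) (a b : X + X -> X + X -> Prop) :
    vertex3 X -> vertex3 X -> Prop :=
  fun p q => image_graph (@ren_lower X) a p q \/ image_graph (@ren_upper X) b p q.

(* For a symmetric e, the reflexive transitive closure relates two vertices
   exactly when they lie in the same connected component. *)
Definition connected (V : Type) (e : V -> V -> Prop) : V -> V -> Prop :=
  clos_refl_trans V e.

Definition mul_edge (X : Type) (a b : X + X -> X + X -> Prop) (u v : X + X) :
    Prop :=
  u <> v /\ connected (product_graph a b) (outer u) (outer v).

Definition one_edge (X : Type) (u v : X + X) : Prop :=
  exists x, (u = inl x /\ v = inr x) \/ (u = inr x /\ v = inl x).

Section Connected.
Context {V : Type}.
Implicit Types (e : V -> V -> Prop) (p q r : V).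

Lemma connected_ind_r e p (P : V -> Prop) :
  P p -> (forall q r, connected e p q -> P q -> e q r -> P r) ->
  forall q, connected e p q -> P q.
Proof.
move=> Pp Pstep q /clos_rt_rtn1_iff.
elim=> [//|r s ers pr Pr]; apply: Pstep Pr ers.
exact/clos_rt_rtn1_iff.
Qed.

Lemma connected_step e p q r : connected e p q -> e q r -> connected e p r.
Proof. by move=> pq qr; apply: rt_trans pq _; apply: rt_step. Qed.

Lemma connected_sym e : (forall p q, e p q -> e q p) ->
  forall p q, connected e p q -> connected e q p.
Proof.
move=> es p q; elim=> [x y /es xy|x|x y z _ yx _ zy]; first exact: rt_step.
  exact: rt_refl.
exact: rt_trans zy yx.
Qed.

End Connected.

Lemma connected_map (V W : Type) (f : V -> W) (e : V -> V -> Prop)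
    (e' : W -> W -> Prop) :
  (forall u v, e u v -> connected e' (f u) (f v)) ->
  forall u v, connected e u v -> connected e' (f u) (f v).
Proof.
move=> ee' u v; elim=> [x y|x|x y z _ xy _ yz]; first exact: ee'.
  exact: rt_refl.
exact: rt_trans xy yz.
Qed.

Lemma connected_sub (V : Type) (e e' : V -> V -> Prop) :
  (forall p q, e p q -> connected e' p q) ->
  forall p q, connected e p q -> connected e' p q.
Proof. exact: (@connected_map _ _ id). Qed.

Lemma connected_image (V W : Type) (f : V -> W) (e : V -> V -> Prop) u v :
  injective f ->
  connected (image_graph f e) (f u) (f v) <-> connected e u v.
Proof.
move=> fI; split; last first.
  by apply: connected_map => {}u {}v uv; apply: rt_step; exists u, v.
suff H q : connected (image_graph f e) (f u) q ->
    exists2 w, f w = q & connected e u w.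
  by move=> /H[w /fI ->].
move: q; refine (connected_ind_r _ _); first by exists u => //; apply: rt_refl.
move=> q r _ [w <- uw] [x [y [xy /fI xw <-]]]; exists y => //.
by apply: connected_step uw _; rewrite -xw.
Qed.

Section Product.
Context {X : Type}.
Implicit Types a b c : brauer_graph X.

Lemma ren_lower_inj : injective (@ren_lower X).
Proof. by move=> [x|x] [y|y] //= [->]. Qed.

Lemma ren_upper_inj : injective (@ren_upper X).
Proof. by move=> [x|x] [y|y] //= [->]. Qed.

Lemma outer_inj : injective (@outer X).
Proof. by move=> [x|x] [y|y] //= [->]. Qed.

Lemma image_graph_sym (V W : Type) (f : V -> W) (e : V -> V -> Prop) :
  (forall u v, e u v -> e v u) ->
  forall p q, image_graph f e p q -> image_graph f e q p.
Proof. by move=> es p q [u [v [/es uv <- <-]]]; exists v, u. Qed.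

Lemma image_graph_uniq (V W : Type) (f : V -> W) (e : V -> V -> Prop) :
  injective f -> (forall u v w, e u v -> e u w -> v = w) ->
  forall p q r, image_graph f e p q -> image_graph f e p r -> q = r.
Proof.
move=> fI eu p q r [u [v [uv <- <-]]] [u' [w [uw /fI uu' <-]]].
by move: uw; rewrite uu' => uw; rewrite (eu _ _ _ uv uw).
Qed.

Lemma product_graph_sym a b p q :
  product_graph a b p q -> product_graph a b q p.
Proof.
by move=> [] pq; [left|right]; apply: image_graph_sym pq; apply: edge_sym.
Qed.

(* The edges of Π(a, b) coming from a (s = true) or from b (s = false). *)
Let side a b (s : bool) : vertex3 X -> vertex3 X -> Prop :=
  if s then image_graph (@ren_lower X) a else image_graph (@ren_upper X) b.

Let side_sym a b s p q : side a b s p q -> side a b s q p.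
Proof. by case: s => /=; apply: image_graph_sym; apply: edge_sym. Qed.

Let side_uniq a b s p q r : side a b s p q -> side a b s p r -> q = r.
Proof.
case: s => /=; apply: image_graph_uniq; do ?exact: edge_uniq.
  exact: ren_lower_inj.
exact: ren_upper_inj.
Qed.

Let side_outer a b s u q : side a b s (outer u) q -> s = if u is inl _ then true else false.
Proof.
by case: s => /= -[[x|x] [v [_]]]; case: u.
Qed.

(* alt s n p q: q is reached from p by n edges, alternately from the two
   sides, the next side to be used being s. *)
Fixpoint alt a b (s : bool) (n : nat) (p : vertex3 X) (t : bool) q : Prop :=
  if n is n'.+1 then exists2 r, alt a b s n' p (~~ t) r & side a b (~~ t) r q
  else p = q /\ s = t.

Let alt_uniq a b s n p t t' q q' :
  alt a b s n p t q -> alt a b s n p t' q' -> t = t' /\ q = q'.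
Proof.
elim: n t t' q q' => [|n IH] t t' q q' /=; first by move=> [<- <-] [<- <-].
move=> [r pr rq] [r' pr' r'q'].
have [tt' rr'] := IH _ _ _ _ pr pr'; have {}tt' := negb_inj tt'.
by subst t' r'; split=> //; apply: side_uniq rq r'q'.
Qed.

Let alt_connected a b u q : let s := if u is inl _ then true else false in
  connected (product_graph a b) (outer u) q ->
  exists n t, alt a b s n (outer u) t q.
Proof.
move=> s; move: q; refine (connected_ind_r _ _); first by exists 0, s.
move=> q r _ [n [t uq]] qr.
have [s' {}qr] : exists s', side a b s' q r by case: qr; [exists true|exists false].
have [st|st] := eqVneq s' t.
  by exists n.+1, (~~ t); exists q; rewrite /= negbK // -st.
have {}st : s' = ~~ t by move: st; clear; case: s'; case: t.
subst s'.
case: n uq => [|n] /= => [[uq st]|[r' ur' r'q]].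
  by subst q t; move/side_outer: qr; rewrite -/s; case: (s).
by exists n, (~~ t); rewrite (side_uniq qr (side_sym r'q)).
Qed.

Let alt_stop a b s n m p t t' u q :
  alt a b s n p t (outer u) -> (0 < n)%N ->
  alt a b s m p t' q -> (m <= n)%N.
Proof.
move=> pu n0 pq; rewrite leqNgt; apply/negP => nm.
have [r [t'' pr]] : exists r t'', alt a b s n.+1 p t'' r.
  elim: m nm t' q pq => [//|m IH] nm t' q.
  move: nm; rewrite ltnS leq_eqVlt => /predU1P[->|nm]; first by exists q, t'.
  by move=> [r pr _]; apply: IH nm _ _ pr.
case: pr => r' /= pr' r'r.
have [tt' ur'] := alt_uniq pu pr'; subst t r'.
case: n n0 pu {nm pr'} => //= n _ [w _ /side_sym/side_outer].
by move/side_outer: r'r => <-; case: (t'').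
Qed.

Lemma mul_edge_irrefl a b u : ~ mul_edge a b u u.
Proof. by case. Qed.

Lemma mul_edge_sym a b u v : mul_edge a b u v -> mul_edge a b v u.
Proof.
move=> [uv cuv]; split; first by move/esym.
by apply: connected_sym cuv; apply: product_graph_sym.
Qed.

Lemma mul_edge_uniq a b u v w :
  mul_edge a b u v -> mul_edge a b u w -> v = w.
Proof.
move=> [uv /alt_connected[n [t nv]]] [uw /alt_connected[m [t' mw]]].
have n0 : (0 < n)%N by case: n nv => // -[/outer_inj].
have m0 : (0 < m)%N by case: m mw => // -[/outer_inj].
have nm : n = m.
  apply/eqP; rewrite eqn_leq; apply/andP; split.
    exact: alt_stop mw m0 nv.
  exact: alt_stop nv n0 mw.
by subst m; have [_ /outer_inj] := alt_uniq nv mw.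
Qed.

Definition brauer_mul a b : brauer_graph X :=
  BrauerGraph (@mul_edge_irrefl a b) (@mul_edge_sym a b) (@mul_edge_uniq a b).

Lemma one_edge_irrefl (u : X + X) : ~ one_edge u u.
Proof. by move=> [x [] [->]]. Qed.

Lemma one_edge_sym (u v : X + X) : one_edge u v -> one_edge v u.
Proof. by move=> [x [] [-> ->]]; exists x; [right|left]. Qed.

Lemma one_edge_uniq (u v w : X + X) : one_edge u v -> one_edge u w -> v = w.
Proof. by move=> [x [] [-> ->]] [y [] [] // [->]]. Qed.

Definition brauer_one : brauer_graph X :=
  BrauerGraph one_edge_irrefl one_edge_sym one_edge_uniq.

Let connected_edge a u v : connected a u v -> u = v \/ a u v.
Proof.
move: v; refine (connected_ind_r _ _); first by left.
move=> w w' _ [<-|uw] ww'; first by right.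
by left; apply: edge_uniq ww'; apply: edge_sym.
Qed.

Lemma brauer_mul1g : left_id brauer_one brauer_mul.
Proof.
move=> a; apply: brauer_graphP => u v; split.
- pose f (p : vertex3 X) : X + X :=
    match p with upper x | middle x => inl x | lower x => inr x end.
  have fo w : f (outer w) = w by case: w.
  move=> [uv]; suff /[apply] : forall p q,
      connected (product_graph brauer_one a) p q -> connected a (f p) (f q).
    by rewrite !fo => /connected_edge[].
  apply: connected_map => p q [] [u' [v' [/= u'v' <- <-]]].
    by case: u'v' => x [] [-> ->] /=; apply: rt_refl.
  by apply: rt_step; case: u' v' u'v' => ? [].
move=> uv; split; first by move=> uv'; subst v; apply: edge_irrefl uv.
have H w : connected (product_graph brauer_one a) (outer w) (ren_upper w).
  case: w => x /=; last exact: rt_refl.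
  by apply: rt_step; left; exists (inl x), (inr x); split=> //; exists x; left.
apply: rt_trans (H u) _; apply: (@rt_trans _ _ _ (ren_upper v)).
  by apply: rt_step; right; exists u, v.
by apply: connected_sym (H v); apply: product_graph_sym.
Qed.

Lemma brauer_mulg1 : right_id brauer_one brauer_mul.
Proof.
move=> a; apply: brauer_graphP => u v; split.
- pose f (p : vertex3 X) : X + X :=
    match p with upper x => inl x | middle x | lower x => inr x end.
  have fo w : f (outer w) = w by case: w.
  move=> [uv]; suff /[apply] : forall p q,
      connected (product_graph a brauer_one) p q -> connected a (f p) (f q).
    by rewrite !fo => /connected_edge[].
  apply: connected_map => p q [] [u' [v' [/= u'v' <- <-]]].
    by apply: rt_step; case: u' v' u'v' => ? [].
  by case: u'v' => x [] [-> ->] /=; apply: rt_refl.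
move=> uv; split; first by move=> uv'; subst v; apply: edge_irrefl uv.
have H w : connected (product_graph a brauer_one) (outer w) (ren_lower w).
  case: w => x /=; first exact: rt_refl.
  by apply: rt_step; right; exists (inr x), (inl x); split=> //; exists x; right.
apply: rt_trans (H u) _; apply: (@rt_trans _ _ _ (ren_lower v)).
  by apply: rt_step; left; exists u, v.
by apply: connected_sym (H v); apply: product_graph_sym.
Qed.

End Product.

(* Contracting the walks of r between the vertices f u into single edges
   preserves connectedness along r together with the edges s. *)
Lemma connected_contract (V W : Type) (f : V -> W) (r s : W -> W -> Prop) :
  (forall p q, s p q -> exists u v, f u = p /\ f v = q) ->
  forall u v,
  connected (fun p q => r p q \/ s p q) (f u) (f v) <->
  connected (fun p q => image_graph f
    (fun u v => u <> v /\ connected r (f u) (f v)) p q \/ s p q) (f u) (f v).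
Proof.
set R := image_graph _ _ => sf u v; split; last first.
  apply: connected_sub => p q [[u' [v' [[_ u'v'] <- <-]]]|pq].
    by apply: connected_sub u'v' => *; apply: rt_step; left.
  by apply: rt_step; right.
have short u' v' : connected r (f u') (f v') ->
    connected (fun p q => R p q \/ s p q) (f u') (f v').
  move=> u'v'; have [->|ne] := pselect (u' = v'); first exact: rt_refl.
  by apply: rt_step; left; exists u', v'.
suff H q : connected (fun p q => r p q \/ s p q) (f u) q ->
    exists2 w, connected (fun p q => R p q \/ s p q) (f u) (f w) &
      connected r (f w) q.
  by move=> /H[w uw /short wv]; apply: rt_trans uw wv.
move: q; refine (connected_ind_r _ _); first by exists u; apply: rt_refl.
move=> q t _ [w uw wq] [qt|qt]; first by exists w => //; apply: connected_step qt.
have [x [y [xq yt]]] := sf _ _ qt; subst q t.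
exists y; last exact: rt_refl.
by apply: connected_step (rt_trans _ _ _ _ _ uw (short _ _ wq)) _; right.
Qed.

Section Associativity.
Context {X : Type}.
Implicit Types a b c : brauer_graph X.

(* The four layers of the graph stacking three Brauer graphs. *)
Let layer (n : nat) (x : X) : nat * X := (n, x).
Let emb (i j : nat) (u : X + X) : nat * X :=
  match u with inl x => layer i x | inr x => layer j x end.
Let emb3 (i j k : nat) (p : vertex3 X) : nat * X :=
  match p with upper x => layer i x | middle x => layer j x | lower x => layer k x end.

Let emb3_inj (i j k : nat) : i != j -> j != k -> i != k -> injective (emb3 i j k).
Proof.
move=> /eqP ij /eqP jk /eqP ik [x|x|x] [y|y|y] // [] //.
all: by [move=> -> | move=> /esym | move=> ? ->].
Qed.

Let image_emb3 i j k (a b : X + X -> X + X -> Prop) p q :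
  image_graph (emb3 i j k) (product_graph a b) p q <->
  image_graph (emb i j) a p q \/ image_graph (emb j k) b p q.
Proof.
split=> [[p' [q' [[]]]]|[]].
- by move=> [u [v [uv <- <-]]] <- <-; left; exists u, v; split=> //; [case: u {uv} | case: v {uv}].
- by move=> [u [v [uv <- <-]]] <- <-; right; exists u, v; split=> //; [case: u {uv} | case: v {uv}].
- move=> [u [v [uv <- <-]]]; exists (ren_lower u), (ren_lower v).
  by split; [left; exists u, v | case: u {uv} | case: v {uv}].
- move=> [u [v [uv <- <-]]]; exists (ren_upper u), (ren_upper v).
  by split; [right; exists u, v | case: u {uv} | case: v {uv}].
Qed.

Let stack a b c p q := 
  [\/ image_graph (emb 0 1) a p q, image_graph (emb 1 2) b p q |
      image_graph (emb 2 3) c p q].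

Let connected_eq (V : Type) (e e' : V -> V -> Prop) :
  (forall p q, e p q <-> e' p q) -> connected e = connected e'.
Proof.
by move=> ee'; congr connected; apply/funext => p; apply/funext => q; apply/propext.
Qed.

Let mul_edge_emb (i j k : nat) a b (u v : X + X) : i != j -> j != k -> i != k ->
  mul_edge a b u v <-> u <> v /\
  connected (fun p q => image_graph (emb i j) a p q \/ image_graph (emb j k) b p q)
    (emb i k u) (emb i k v).
Proof.
move=> ij jk ik; rewrite -(connected_eq (image_emb3 i j k a b)).
have o w : emb i k w = emb3 i j k (outer w) by case: w.
by rewrite !o /mul_edge (connected_image _ _ _ (emb3_inj ij jk ik)).
Qed.

Let mulA_left a b c u v : brauer_mul (brauer_mul a b) c u v <->
  u <> v /\ connected (stack a b c) (emb 0 3 u) (emb 0 3 v).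
Proof.
apply: (iff_trans (@mul_edge_emb 0 2 3 _ _ _ _ _ _ _)) => //.
apply: and_iff_compat_l.
pose r p q := image_graph (emb 0 1) a p q \/ image_graph (emb 1 2) b p q.
pose s := image_graph (emb 2 3) c.
pose f := emb3 0 2 3.
have e3 w : emb 0 3 w = f (outer w) by case: w.
have stackE : connected (stack a b c) = connected (fun p q => r p q \/ s p q).
  apply: connected_eq => p q; rewrite /stack /r /s.
  by split=> [[]|[[]|]]; [left; left|left; right|right|constructor 1|constructor 2|constructor 3].
rewrite stackE !e3 (@connected_contract _ _ f r s); last first.
  move=> p q [u' [v' [_ <- <-]]]; exists (ren_upper u'), (ren_upper v').
  by split; [case: u' | case: v'].
set R := (fun u v => u <> v /\ _).
have RE p q : image_graph (emb 0 2) (brauer_mul a b) p q <-> image_graph f R p q.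
  split=> [[u' [v' [/(@mul_edge_emb 0 1 2)[]// ne uv <- <-]]]|].
    have e2 w : emb 0 2 w = f (ren_lower w) by case: w.
    exists (ren_lower u'), (ren_lower v'); rewrite -!e2; split=> //.
    by split; [move/ren_lower_inj | rewrite -!e2].
  move=> [p' [q' [[ne pq] <- <-]]].
  have low x t : connected r (layer 3 x) t -> t = layer 3 x.
    move: t; refine (connected_ind_r _ _) => // y z _ -> [] [u' [v' [_]]].
      by case: u'.
    by case: u'.
  have rs p1 q1 : r p1 q1 -> r q1 p1.
    by move=> [] pq1; [left|right]; apply: image_graph_sym pq1; apply: edge_sym.
  have fI : injective f by apply: emb3_inj.
  have H p1 q1 : p1 <> q1 -> connected r (f p1) (f q1) ->
      exists2 u1, p1 = ren_lower u1 & f p1 = emb 0 2 u1.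
    case: p1 => [x|x|x] ne1; [by exists (inl x)|by exists (inr x)|].
    by move/low => /(fI q1 (lower x)) /esym.
  have [u' pu fu] := H _ _ ne pq.
  have [v' qv fv] := H _ _ (nesym ne) (connected_sym rs pq).
  exists u', v'; rewrite -fu -fv; split=> //.
  by apply/(@mul_edge_emb 0 1 2) => //; rewrite -fu -fv; split=> // uv; apply: ne; rewrite pu qv uv.
by rewrite (connected_eq (e' := fun p q => image_graph f R p q \/ s p q)) // => p q; rewrite RE.
Qed.

Let mulA_right a b c u v : brauer_mul a (brauer_mul b c) u v <->
  u <> v /\ connected (stack a b c) (emb 0 3 u) (emb 0 3 v).
Proof.
apply: (iff_trans (@mul_edge_emb 0 1 3 _ _ _ _ _ _ _)) => //.
apply: and_iff_compat_l.
pose r p q := image_graph (emb 1 2) b p q \/ image_graph (emb 2 3) c p q.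
pose s := image_graph (emb 0 1) a.
pose f := emb3 0 1 3.
have e3 w : emb 0 3 w = f (outer w) by case: w.
have stackE : connected (stack a b c) = connected (fun p q => r p q \/ s p q).
  apply: connected_eq => p q; rewrite /stack /r /s.
  by split=> [[]|[[]|]]; [right|left; left|left; right|constructor 2|constructor 3|constructor 1].
rewrite stackE !e3 (@connected_contract _ _ f r s); last first.
  move=> p q [u' [v' [_ <- <-]]]; exists (ren_lower u'), (ren_lower v').
  by split; [case: u' | case: v'].
set R := (fun u v => u <> v /\ _).
have RE p q : image_graph (emb 1 3) (brauer_mul b c) p q <-> image_graph f R p q.
  split=> [[u' [v' [/(@mul_edge_emb 1 2 3)[]// ne uv <- <-]]]|].
    have e2 w : emb 1 3 w = f (ren_upper w) by case: w.
    exists (ren_upper u'), (ren_upper v'); rewrite -!e2; split=> //.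
    by split; [move/ren_upper_inj | rewrite -!e2].
  move=> [p' [q' [[ne pq] <- <-]]].
  have low x t : connected r (layer 0 x) t -> t = layer 0 x.
    move: t; refine (connected_ind_r _ _) => // y z _ -> [] [u' [v' [_]]].
      by case: u'.
    by case: u'.
  have rs p1 q1 : r p1 q1 -> r q1 p1.
    by move=> [] pq1; [left|right]; apply: image_graph_sym pq1; apply: edge_sym.
  have fI : injective f by apply: emb3_inj.
  have H p1 q1 : p1 <> q1 -> connected r (f p1) (f q1) ->
      exists2 u1, p1 = ren_upper u1 & f p1 = emb 1 3 u1.
    case: p1 => [x|x|x] ne1; [|by exists (inl x)|by exists (inr x)].
    by move/low => /(fI q1 (upper x)) /esym.
  have [u' pu fu] := H _ _ ne pq.
  have [v' qv fv] := H _ _ (nesym ne) (connected_sym rs pq).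
  exists u', v'; rewrite -fu -fv; split=> //.
  by apply/(@mul_edge_emb 1 2 3) => //; rewrite -fu -fv; split=> // uv; apply: ne; rewrite pu qv uv.
rewrite (connected_eq (e' := fun p q => image_graph f R p q \/ s p q)) // => p q.
by rewrite RE or_comm.
Qed.

Lemma brauer_mulA : associative (@brauer_mul X).
Proof.
by move=> a b c; apply: brauer_graphP => u v; rewrite mulA_left mulA_right.
Qed.

End Associativity.

HB.instance Definition _ (X : Type) :=
  isSemigroup.Build (brauer_graph X) (@brauer_mulA X).
HB.instance Definition _ (X : Type) :=
  Magma_isUMagma.Build (brauer_graph X) (@brauer_mul1g X) (@brauer_mulg1 X).

Section Semigroups.

Definition idempotents (S : semigroupType) : set S := [set x | x * x = x].

Definition left_units (M : monoidType) : set M :=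
  [set x | exists a, a * x = 1].

Definition units (M : monoidType) : set M :=
  [set x | (exists a, a * x = 1) /\ (exists b, x * b = 1)].

Definition mul_stable (S : semigroupType) (A : set S) : Prop :=
  forall x y, A x -> A y -> A (x * y).

Definition generated (S : semigroupType) (U : set S) : set S :=
  smallest (@mul_stable S) U.

(* rank (S : A) = |K|; the ambient semigroup T only supplies the product. *)
Definition has_relative_rank (T : semigroupType) (S A : set T)
    (I : Type) (K : set I) : Prop :=
  (exists U : set T, [/\ U `<=` S, S = generated (A `|` U) & (U #= K)%card]) /\
  (forall U : set T, U `<=` S -> S = generated (A `|` U) -> (K #<= U)%card).

End Semigroups.

Section BrauerNotions.
Context {X : Type}.

Definition Dom (a : brauer_graph X) : set X :=
  [set x | exists y, a (inl x) (inr y)].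

Definition Codom (a : brauer_graph X) : set X :=
  [set y | exists x, a (inl x) (inr y)].

(* A cardinal at most |X| is represented by the set of all subsets of X having
   that cardinality. *)
Definition cardinal_of (A : set X) : set (set X) := [set B | (B #= A)%card].

Definition card_lt (mu nu : set (set X)) : Prop :=
  exists A B, [/\ mu A, nu B, (A #<= B)%card & ~~ (B #<= A)%card].

Definition def (a : brauer_graph X) : set (set X) := cardinal_of (~` Dom a).

Definition codef (a : brauer_graph X) : set (set X) := cardinal_of (~` Codom a).

End BrauerNotions.

Definition card_one (X : Type) : set (set X) := [set A | (A #= [set: unit])%card].
Arguments card_one X _ : clear implicits.

Definition infinite_cardinals (X : Type) : set (set (set X)) :=
  [set cardinal_of A | A in [set A : set X | ([set: nat] #<= A)%card]].
Arguments infinite_cardinals X _ : clear implicits.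

(* A set of cardinality 1 + rho, where rho = |infinite_cardinals X|. *)
Definition one_plus_rho (X : Type) : set (unit + infinite_cardinals X) := setT.
Arguments one_plus_rho X _ : clear implicits.

Definition FL (X : Type) : set (brauer_graph X) :=
  generated (@idempotents (brauer_graph X) `|` @left_units (brauer_graph X)).
Arguments FL X _ : clear implicits.

Definition F (X : Type) : set (brauer_graph X) :=
  generated (@idempotents (brauer_graph X) `|` @units (brauer_graph X)).
Arguments F X _ : clear implicits.

(* Main.v *)
From mathcomp Require Import all_boot finmap zify.
From mathcomp Require Import boolp classical_sets functions cardinality.
Require Import Defs.

(** Write def and codef for the numbers of upper and of lower vertices that are
    in no transversal.

    First, F consists of the graphs with def = codef, and FL of those with
    codef <= def ([F_def_eq_codef], [def_eq_codef_F], [FL_codef_le_def],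
    [codef_le_def_FL]).  A graph factors as upper idempotent, graph of an
    injection g of X, lower idempotent, as soon as some injection g extends the
    partial bijection given by the transversals, read from bottom to top; the
    idempotents carry the hooks.  Such a g exists if codef <= def, and can be
    chosen bijective if def = codef; the graph of g is a left unit, and a unit
    if g is bijective.
    In the other direction the class codef <= def has to be shown stable under
    products and to contain the idempotents.  A transversal of a is destroyed in
    ab only if it runs into a non-transversal vertex of b, which bounds the
    defects of ab in terms of those of a and b; for infinite cardinals these
    bounds decide everything, because an infinite cardinal is not the sum of two
    smaller ones.  If all defects are finite then def - codef is additive, like
    a Fredholm index ([index_mul]).

    Next, say that a graph drops at a cardinal mu if codef < mu = def.  If mu is
    infinite or 1, and ab drops at mu for a, b in FL, then a or b drops at mu
    ([drops_mul]).  No element of F drops anywhere, and for each such mu there is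
    a left unit that drops at mu; hence a set U generating FL together with F
    contains for each mu an element that drops at mu, and these are distinct
    since mu is their defect.

    Finally, this condition on U suffices.  By the factorization it is enough to
    generate the graphs of injections, which goes by induction on the cardinal
    mu of the complement of the range ([drops_sufficient]).  If a drops at mu,
    the induction hypothesis yields the graph of an injection with range the
    codomain of a; multiplying a by it turns a into a left unit of defect mu,
    and all injections whose range has a complement of size mu arise from this
    one by permuting X and removing hooks.  A finite mu > 1 is reached by
    composing injections that miss fewer points.

    So the sets U in question are those that meet every class of graphs dropping
    at a given mu ([generates_iff]); both parts of the theorem follow, the
    second because an injection between finite sets of equal size is onto. *)

Set Implicit Arguments.
Unset Strict Implicit.
Unset Printing Implicit Defensive.

Local Open Scope classical_set_scope.
Local Open Scope card_scope.

(** * Cardinals *)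

Lemma card_le_inj (T U : Type) (A : set T) (B : set U) (f : T -> U) :
  (forall x, A x -> B (f x)) ->
  (forall x x', A x -> A x' -> f x = f x' -> x = x') -> A #<= B.
Proof.
move=> fAB finj.
have h : $|{injfun A >-> B}|.
  apply/injfunPex; exists f => // x x' /set_mem Ax /set_mem Ax'; exact: finj.
by case: h => h; apply: inj_card_le h.
Qed.

Lemma card_le_rel (T U : Type) (A : set T) (B : set U) (R : T -> U -> Prop) :
  (forall x, A x -> exists2 y, B y & R x y) ->
  (forall x x' y, A x -> A x' -> R x y -> R x' y -> x = x') ->
  A #<= B.
Proof.
move=> RAB Rinj.
have [->|/set0P[x0 Ax0]] := eqVneq A set0; first exact: card_ge0.
have [y0 _ _] := RAB _ Ax0.
have /choice[f fP] : forall x, exists y, A x -> B y /\ R x y.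
  move=> x; have [/RAB[y By Rxy]|nAx] := pselect (A x); first by exists y.
  by exists y0.
apply: (@card_le_inj _ _ _ _ f) => [x /fP[]//|x x' Ax Ax' ff].
by have [_ Rx] := fP _ Ax; have [_] := fP _ Ax'; rewrite -ff; apply: Rinj.
Qed.

Lemma card_le_injP (T U : Type) (A : set T) (B : set U) : U ->
  A #<= B -> exists f : T -> U, (forall x, A x -> B (f x)) /\
  (forall x x', A x -> A x' -> f x = f x' -> x = x').
Proof.
elim/Ppointed: U => U in B * => [/no//|_ /pcard_leP[f]].
exists f; split=> [x Ax|x x' Ax Ax' ff]; first exact: funS.
by apply: (@inj _ _ _ f) => //; apply: mem_set.
Qed.

Lemma card_eq_bijP (T U : Type) (A : set T) (B : set U) : U ->
  A #= B -> exists f : T -> U, [/\ forall x, A x -> B (f x),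
  forall x x', A x -> A x' -> f x = f x' -> x = x' &
  forall y, B y -> exists2 x, A x & f x = y].
Proof.
elim/Ppointed: U => U in B * => [/no//|_ /pcard_eqP[f]].
exists f; split=> [x Ax|x x' Ax Ax' ff|y By]; first exact: funS.
  by apply: (@inj _ _ _ f) => //; apply: mem_set.
by have [x Ax <-] := @surj _ _ _ _ f y By; exists x.
Qed.

(** Any family of cardinals has a least member.  A maximal set of choice
    functions of the family no two of which agree anywhere must, by maximality,
    exhaust some member F i; mapping the value at i of such a function to its
    value at j then embeds F i into F j. *)
Lemma card_le_least (T I : Type) (F : I -> set T) (i0 : I) :
  exists i, forall j, F i #<= F j.
Proof.
pose P (S : set (I -> T)) := (forall s i, S s -> F i (s i)) /\
  (forall s s' i, S s -> S s' -> s i = s' i -> s = s').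
have [S [[SF Sinj] Smax]] : exists S, P S /\ forall S', S `<` S' -> ~ P S'.
  apply: Zorn_bigcup => C CP Ctot; split=> [s i [S CS Ss]|s s' i].
    by have [/(_ s i Ss)] := CP _ CS.
  move=> [S CS Ss] [S' CS' Ss'].
  case: (Ctot _ _ CS CS') => SS'.
    by have [_ /(_ s s' i)] := CP _ CS'; apply=> //; apply: SS'.
  by have [_ /(_ s s' i)] := CP _ CS; apply=> //; apply: SS'.
have [[i Si]|nS] := pselect (exists i, forall x, F i x ->
    exists2 s, S s & s i = x).
  pose R i j x y := exists s, [/\ S s, s i = x & s j = y].
  exists i => j; apply: (@card_le_rel _ _ _ _ (R i j)).
    by move=> x /Si[s Ss <-]; exists (s j); [apply: SF|exists s].
  move=> x x' y _ _ [s [Ss <- sy]] [s' [Ss' <- s'y]].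
  by rewrite (Sinj s s' j) // sy s'y.
have /choice[s sP] : forall i, exists x, F i x /\ forall s', S s' -> s' i <> x.
  move=> i; apply: contrapT => ni; apply: nS; exists i => x Fx.
  apply: contrapT => nx; apply: ni; exists x; split=> // s' Ss' s'x.
  by apply: nx; exists s'.
have nSs : ~ S s by move=> Ss; have [_ /(_ _ Ss)] := sP i0.
have /Smax[] : S `<` S `|` [set s].
  by split=> [t St|/(_ s)]; [left|move=> Ss; apply/nSs/Ss; right].
split=> [t i [/SF//|->]|t t' i [St|->] [St'|->]//]; first by have [] := sP i.
- exact: Sinj.
- by move=> ts; have [_ /(_ _ St)] := sP i.
- by move=> ts; have [_ /(_ _ St')] := sP i; rewrite ts.
Qed.

Lemma card_le_total (T : Type) (A B : set T) : A #<= B \/ B #<= A.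
Proof.
have [[] h] := card_le_least (fun b : bool => if b then A else B) true.
  by left; apply: (h false).
by right; apply: (h true).
Qed.

Lemma card_lt_ind (T : Type) (P : set T -> Prop) :
  (forall M, (forall N, ~~ (M #<= N) -> P N) -> P M) -> forall M, P M.
Proof.
move=> Pind M; apply: contrapT => nPM.
pose I := {N : set T | ~ P N}.
have [[N nPN] Nmin] := card_le_least (fun N : I => sval N) (exist _ M nPM).
apply: (nPN); apply: Pind => N' /negP NN'; apply: contrapT => nPN'.
exact: NN' (Nmin (exist _ N' nPN')).
Qed.

Definition doubling (T : Type) (D : set T) :=
  exists f g : T -> T, [/\ forall x, D x -> D (f x) /\ D (g x),
    forall x y, D x -> D y -> f x = f y -> x = y,
    forall x y, D x -> D y -> g x = g y -> x = y &
    forall x y, D x -> D y -> f x <> g y].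

(** Two injections of D into itself with disjoint ranges make room in D for two
    sets of size at most that of D. *)
Lemma doubling_card_setU (T U : Type) (D : set T) (A B : set U) :
  doubling D -> A #<= D -> B #<= D -> A `|` B #<= D.
Proof.
move=> [f [g [fgD finj ginj fg]]] AD BD.
have [->|/set0P[x0 Ax0]] := eqVneq (A `|` B) set0; first exact: card_ge0.
have [x1 _] : exists x, D x.
  case: (boolP (D == set0)) => [/eqP D0|/set0P//].
  move: AD BD Ax0; rewrite D0 => /card_le0P -> /card_le0P ->.
  by rewrite setU0 => -[].
have [h [hD hinj]] := card_le_injP x1 AD.
have [k [kD kinj]] := card_le_injP x1 BD.
pose R x y := (A x /\ y = f (h x)) \/ [/\ ~ A x, B x & y = g (k x)].
apply: (@card_le_rel _ _ _ _ R).
  move=> x ABx; have [Ax|nAx] := pselect (A x).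
    by exists (f (h x)); [apply: (fgD _ (hD _ Ax)).1|left].
  have Bx : B x by case: ABx.
  by exists (g (k x)); [apply: (fgD _ (kD _ Bx)).2|right].
move=> x x' y _ _ [[Ax ->]|[nAx Bx ->]] [[Ax' e]|[nAx' Bx' e]].
- by apply: hinj => //; apply: finj e; apply: hD.
- by case: (fg _ _ (hD _ Ax) (kD _ Bx') e).
- by case: (fg _ _ (hD _ Ax') (kD _ Bx) (esym e)).
- by apply: kinj => //; apply: ginj e; apply: kD.
Qed.

(** Zorn's lemma on pairs of partial self-injections of A with disjoint ranges
    and a common domain containing these ranges.  If the complement of the domain
    were infinite, a maximal pair could be extended to a sequence of new points
    by n |-> 2n and n |-> 2n + 1. *)
Lemma infinite_doubling (T : Type) (A : set T) : infinite_set A ->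
  exists D, [/\ D `<=` A, finite_set (A `\` D) & doubling D].
Proof.
move=> Ainf.
(* A pair (f, g) is encoded by the set of triples (x, f x, g x). *)
pose dom (R : set (T * T * T)) := [set x | exists y z, R (x, y, z)].
pose P (R : set (T * T * T)) :=
  [/\ forall x y z, R (x, y, z) -> [/\ A x, dom R y & dom R z],
   forall x y z y' z', R (x, y, z) -> R (x, y', z') -> y = y' /\ z = z',
   forall x y z x' z', R (x, y, z) -> R (x', y, z') -> x = x',
   forall x y z x' y', R (x, y, z) -> R (x', y', z) -> x = x' &
   forall x y z x' z', R (x, y, z) -> R (x', z', y) -> False].
have [R [[RD Rfun Rf Rg Rfg] Rmax]] :
    exists R, P R /\ forall R', R `<` R' -> ~ P R'.
  apply: Zorn_bigcup => C CP Ctot.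
  have C2 t t' : (\bigcup_(X in C) X) t -> (\bigcup_(X in C) X) t' ->
      exists R, [/\ C R, R t & R t'].
    move=> [R CR Rt] [R' CR' Rt'].
    by case: (Ctot _ _ CR CR') => RR'; [exists R'|exists R];
      split=> //; apply: RR'.
  split.
  - move=> x y z [R CR Rt]; have [RD _ _ _ _] := CP _ CR.
    have [Ax [y1 [y2 Ry]] [z1 [z2 Rz]]] := RD _ _ _ Rt.
    by split=> //; [exists y1, y2|exists z1, z2]; exists R.
  - by move=> x y z y' z' /C2/[apply] -[R [/CP[_ h _ _ _]]]; apply: h.
  - by move=> x y z x' z' /C2/[apply] -[R [/CP[_ _ h _ _]]]; apply: h.
  - by move=> x y z x' y' /C2/[apply] -[R [/CP[_ _ _ h _]]]; apply: h.
  - by move=> x y z x' z' /C2/[apply] -[R [/CP[_ _ _ _ h]]]; apply: h.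
exists (dom R); split; first by move=> x [y [z /RD[]]].
  apply: contrapT => /infiniteP Ninf.
  have [a0 _] := infinite_setN0 Ainf.
  have [phi [phiA phiI]] := card_le_injP a0 Ninf.
  have {}phiA n : A (phi n) /\ ~ dom R (phi n) by have [] := phiA n I.
  have {}phiI m n : phi m = phi n -> m = n by apply: phiI.
  pose N : set (T * T * T) :=
    [set t | exists n, t = (phi n, phi n.*2, phi n.*2.+1)].
  have RN t : R `<=` R `|` N by move=> ?; left.
  have : R `<` R `|` N.
    split=> [?|/(_ (phi 0, phi 0, phi 1%N))]; first by left.
    move=> h; have [_] := phiA 0; apply; exists (phi 0), (phi 1%N); apply: h.
    by right; exists 0.
  move/Rmax; apply.
  have domN n : dom (R `|` N) (phi n).
    by exists (phi n.*2), (phi n.*2.+1); right; exists n.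
  have domR x : dom R x -> dom (R `|` N) x by move=> [y [z]]; exists y, z; left.
  have NR x y z n : R (x, y, z) -> [/\ x <> phi n, y <> phi n & z <> phi n].
    move=> Rt; have [Ax dy dz] := RD _ _ _ Rt; have [_ ndn] := phiA n.
    by split=> e; apply: ndn; rewrite -e //; exists y, z.
  have dbl m n : phi m.*2 = phi n.*2 -> m = n.
    by move=> /phiI; apply: double_inj.
  have dblS m n : phi m.*2.+1 = phi n.*2.+1 -> m = n.
    by move=> /phiI[]; apply: double_inj.
  have dbl' m n : phi m.*2 <> phi n.*2.+1.
    by move=> /phiI /(congr1 odd) /=; rewrite !odd_double.
  split.
  - move=> x y z [/RD[Ax dy dz]|[n [-> -> ->]]]; split=> //; try exact: domR.
    by have [] := phiA n.
  - move=> x y z y' z' [Rt|[n [-> -> ->]]] [Rt'|[m [e -> ->]]];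
      first exact: Rfun Rt Rt'.
    + by have [] := NR _ _ _ m Rt.
    + by have [] := NR _ _ _ n Rt'.
    + by rewrite (phiI _ _ e).
  - move=> x y z x' z' [Rt|[n [-> -> _]]] [Rt'|[m [-> e _]]];
      first exact: Rf Rt Rt'.
    + by have [] := NR _ _ _ m.*2 Rt.
    + by have [] := NR _ _ _ n.*2 Rt'.
    + by rewrite (dbl _ _ e).
  - move=> x y z x' y' [Rt|[n [-> _ ->]]] [Rt'|[m [-> _ e]]];
      first exact: Rg Rt Rt'.
    + by have [] := NR _ _ _ m.*2.+1 Rt.
    + by have [] := NR _ _ _ n.*2.+1 Rt'.
    + by rewrite (dblS _ _ e).
  - move=> x y z x' z' [Rt|[n [_ -> _]]] [Rt'|[m [_ _ e]]];
      first exact: Rfg Rt Rt'.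
    + by have [] := NR _ _ _ m.*2.+1 Rt.
    + by have [] := NR _ _ _ n.*2 Rt'.
    + by case: (dbl' _ _ e).
have /choice[f fP] : forall x, exists y, dom R x -> exists z, R (x, y, z).
  move=> x; have [[y [z Rt]]|nd] := pselect (dom R x); last by exists x.
  by exists y => _; exists z.
have /choice[g gP] : forall x, exists z, dom R x -> exists y, R (x, y, z).
  move=> x; have [[y [z Rt]]|nd] := pselect (dom R x); last by exists x.
  by exists z => _; exists y.
exists f, g; split.
- by move=> x dx; have [z /RD[]] := fP _ dx; have [y /RD[]] := gP _ dx.
- by move=> x y /fP[z Rx] /fP[z' Ry] e; rewrite e in Rx; apply: Rf Rx Ry.
- by move=> x y /gP[z Rx] /gP[z' Ry] e; rewrite e in Rx; apply: Rg Rx Ry.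
- by move=> x y /fP[z Rx] /gP[z' Ry] e; rewrite e in Rx; apply: Rfg Rx Ry.
Qed.

Lemma infinite_card_setU (T U : Type) (M : set T) (A B : set U) :
  infinite_set M -> A #<= M -> B #<= M -> A `|` B #<= M.
Proof.
move=> Minf AM BM; have [D [DM MDfin Dspl]] := infinite_doubling Minf.
have Dinf : infinite_set D.
  move=> Dfin; apply: Minf; rewrite -(setDUK DM) finite_setU; split=> //.
have MD : M #<= D.
  rewrite -(setDUK DM); apply: doubling_card_setU => //.
  apply: card_le_trans (iffLR (infiniteP _) Dinf).
  exact: finite_set_countable.
apply: card_le_trans (subset_card_le DM).
by apply: doubling_card_setU => //; apply: card_le_trans MD.
Qed.

(** An infinite cardinal is not the sum of two smaller ones.  All estimates of
    infinite defects below rest on this. *)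
Lemma infinite_card_le_setU (T U : Type) (M : set T) (A B : set U) :
  infinite_set M -> M #<= A `|` B -> M #<= A \/ M #<= B.
Proof.
move=> Minf; wlog AB : A B / A #<= B => [h MAB|MAB].
  have [AB|BA] := card_le_total A B; first exact: h.
  by apply/or_comm; apply: h => //; rewrite setUC.
right; apply: card_le_trans (MAB) _; apply: infinite_card_setU => // Bfin.
apply: Minf; apply: card_le_finite MAB _; rewrite finite_setU; split=> //.
exact: card_le_finite AB Bfin.
Qed.

Lemma card_le_finite_infinite (T U : Type) (A : set T) (B : set U) :
  finite_set A -> infinite_set B -> A #<= B.
Proof.
by move=> /finite_set_countable Afin /infiniteP; apply: card_le_trans.
Qed.

Section Injections.
Context {X : Type}.

Lemma inj_range (B : set X) : [set: X] #<= B ->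
  exists2 g : X -> X, injective g & range g = B.
Proof.
move=> XB; have [[x0 _]|nX] := pselect (exists x : X, True); last first.
  exists id; first by move=> x y.
  by apply/seteqP; split=> x; case: nX; exists x.
have [g [gB gI gS]] : exists f : X -> X, [/\ forall x, [set: X] x -> B (f x),
  forall x x', [set: X] x -> [set: X] x' -> f x = f x' -> x = x' &
  forall y, B y -> exists2 x, [set: X] x & f x = y].
  apply: card_eq_bijP x0 _; apply/card_eqPle.
  by split=> //; apply: subset_card_le.
exists g; first by move=> x y; apply: gI.
apply/seteqP; split=> x; first by move=> [y _ <-]; apply: gB.
by move=> /gS[y _ <-]; exists y.
Qed.

(** X is equipotent to the disjoint union of M and X, since X is infinite; the
    second summand gives the injection, the first one its complement. *)
Lemma inj_compl_range (M : set X) : infinite_set [set: X] ->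
  exists2 g : X -> X, injective g & ~` range g #= M.
Proof.
move=> Xinf; have [x0 _] := infinite_setN0 Xinf.
pose A : set (X + X) := inl @` M `|` range inr.
have : A #= [set: X].
  rewrite card_eq_le; apply/andP; split.
    by apply: infinite_card_setU => //;
      apply: card_le_trans (card_image_le _ _) _ => //; apply: card_leT.
  apply: (@card_le_inj _ _ _ _ inr) => [x _|x x' _ _ []//]; by right; exists x.
move=> /(card_eq_bijP x0)[f [_ fI fS]].
have Ar x : A (inr x) by right; exists x.
have Al m : M m -> A (inl m) by move=> Mm; left; exists m.
exists (f \o inr); first by move=> x y /= /(fI _ _ (Ar x) (Ar y)) [].
rewrite card_eq_le; apply/andP; split.
  apply: (@card_le_rel _ _ _ _ (fun x m => f (inl m) = x)).
    move=> x nx; have [[m|y] Aw fw] := fS x I; last by case: nx; exists y.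
    by exists m => //; case: Aw => [[m' Mm' [<-]]|[]].
  by move=> x x' y _ _ <-.
apply: (@card_le_inj _ _ _ _ (f \o inl)).
  by move=> m Mm [x _] /= /(fI _ _ (Ar x) (Al m Mm)).
by move=> m m' Mm Mm' /= /(fI _ _ (Al m Mm) (Al m' Mm')) [].
Qed.

Lemma eq_compl_range_perm (h k : X -> X) : injective h -> injective k ->
  ~` range h #= ~` range k ->
  exists2 p : X -> X, injective p /\ (forall x, exists y, x = p y) &
    forall y, h y = p (k y).
Proof.
move=> hI kI; have [[x0 _]|nX] := pselect (exists x : X, True); last first.
  by exists id => [|y]; [split=> [x|x]|]; case: nX;
    [exists x|exists x|exists y].
move=> /card_esym /(card_eq_bijP x0)[f [fm fI fS]].
have /choice[p pP] : forall x, exists z,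
    (exists2 y, x = k y & z = h y) \/ ~ range k x /\ z = f x.
  move=> x; have [[y _ yx]|nx] := pselect (range k x).
    by exists (h y); left; exists y.
  by exists (f x); right.
have pk y : p (k y) = h y.
  by case: (pP (k y)) => [[y' /kI -> //]|[[]]]; exists y.
have pf x : ~ range k x -> p x = f x.
  by case: (pP x) => [[y -> _] []|[]//]; exists y.
exists p => //; split=> [x x'|x].
  case: (pselect (range k x)) => [[y _ <-]|nx];
    case: (pselect (range k x')) => [[y' _ <-]|nx']; rewrite ?pk ?pf //.
  - by move=> /hI ->.
  - by move=> e; case: (fm _ nx'); rewrite -e; exists y.
  - by move=> e; case: (fm _ nx); rewrite e; exists y'.
  - exact: fI.
have [[y _ <-]|nx] := pselect (range h x); first by exists (k y).
by have [y ny <-] := fS _ nx; exists y; rewrite pf.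
Qed.

End Injections.

Section FiniteCardinals.
Context {X : Type}.
Implicit Types A B : set X.

Definition fincard A : nat := #|` fset_set (A : set {classic X})|.

Lemma fincard_split A B : finite_set A ->
  fincard A = (fincard (A `&` B) + fincard (A `\` B))%N.
Proof.
move=> Afin; rewrite /fincard -[in LHS](setUIDK A B) fset_setU; last 2 first.
- exact: finite_setIl.
- exact: finite_setD.
rewrite cardfsU; set I := (_ `&` _)%fset.
suff -> : I = fset0 by rewrite cardfs0 subn0.
rewrite /I -fset_setI; last 2 first.
- exact: finite_setIl.
- exact: finite_setD.
by rewrite setIDA (setIC _ A) setIA setIid setDE -setIA setICr setI0 fset_set0.
Qed.

Lemma eq_fincard A B : finite_set A -> A #= B -> fincard A = fincard B.
Proof.
move=> Afin AB; have Bfin : finite_set B by rewrite -(eq_finite_set AB).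
exact/(@fcard_eq {classic X} {classic X}).
Qed.

Lemma card_le_fincard A B : finite_set A -> finite_set B ->
  (A #<= B) = (fincard A <= fincard B)%N.
Proof.
move=> /finite_setP[n An] /finite_setP[m Bm].
rewrite /fincard (@card_fset_set {classic X} _ _ An).
rewrite (@card_fset_set {classic X} _ _ Bm).
by rewrite (card_le_eql An) (card_le_eqr Bm) card_le_II.
Qed.

Lemma fincard_set1 (x : X) : fincard [set x] = 1%N.
Proof. exact: (@card_fset_set {classic X} _ _ card_set1). Qed.

Lemma card_eq_fincard A B : finite_set A -> finite_set B ->
  (A #= B) = (fincard A == fincard B).
Proof. by move=> fA fB; rewrite card_eq_le !card_le_fincard // eqn_leq. Qed.

Lemma fincard0 A : finite_set A -> fincard A = 0 -> A = set0.
Proof.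
move=> fA A0; apply/eqP; rewrite -(card_eq0 (U := X)).
rewrite card_eq_fincard ?A0; last by exact: finite_set0.
  by rewrite /fincard fset_set0.
by [].
Qed.

Lemma finite_sub_card_eq A B : A `<=` B -> finite_set B -> B #<= A -> A = B.
Proof.
move=> AB fB BA; have fA := sub_finite_set AB fB.
have := fincard_split A fB; rewrite (setIidr AB).
have := BA; rewrite card_le_fincard // => le_count count_eq.
have /fincard0 BA0 : fincard (B `\` A) = 0 by lia.
apply/seteqP; split=> // x Bx; apply: contrapT => nAx.
have: (B `\` A) x by split.
by rewrite BA0 //; apply: finite_setD.
Qed.

End FiniteCardinals.

(** * The involution, and transversals of a product *)

Local Open Scope group_scope.

Lemma connected_invariant (V : Type) (e : V -> V -> Prop) (P : V -> Prop) p q :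
  (forall r s, P r -> e r s -> P s) -> P p -> connected e p q -> P q.
Proof.
move=> Pe Pp; move: q; refine (connected_ind_r Pp _) => q r _ Pq.
exact: Pe.
Qed.

Section Star.
Context {X : Type}.
Implicit Types a b : brauer_graph X.

Definition flip (u : X + X) : X + X :=
  match u with inl x => inr x | inr x => inl x end.

Lemma flipK : involutive flip. Proof. by case. Qed.

Lemma star_irrefl a u : ~ a (flip u) (flip u).
Proof. exact: edge_irrefl. Qed.

Lemma star_sym a u v : a (flip u) (flip v) -> a (flip v) (flip u).
Proof. exact: edge_sym. Qed.

Lemma star_uniq a u v w : a (flip u) (flip v) -> a (flip u) (flip w) -> v = w.
Proof. by move=> uv uw; apply: (can_inj flipK); apply: edge_uniq uv uw. Qed.

(** Turning a graph upside down exchanges defect and codefect and reverses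
    products, so each statement on upper vertices has a dual for lower ones. *)
Definition star a : brauer_graph X :=
  BrauerGraph (@star_irrefl a) (@star_sym a) (@star_uniq a).

Lemma starK : involutive star.
Proof. by move=> a; apply: brauer_graphP => u v /=; rewrite !flipK. Qed.

Lemma Dom_star a : Dom (star a) = Codom a.
Proof. by apply/seteqP; split=> x [y /edge_sym xy]; exists y. Qed.

Lemma Codom_star a : Codom (star a) = Dom a.
Proof. by rewrite -Dom_star starK. Qed.

Definition flip3 (p : vertex3 X) : vertex3 X :=
  match p with
  | upper x => lower x | middle x => middle x | lower x => upper x
  end.

Lemma product_graph_flip a b p q :
  product_graph a b p q -> product_graph (star b) (star a) (flip3 p) (flip3 q).
Proof.
move=> [] [u [v [uv <- <-]]]; [right|left]; exists (flip u), (flip v);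
  rewrite /= !flipK; split=> //; by [case: u {uv} | case: v {uv}].
Qed.

Lemma star_mul a b : star (a * b) = star b * star a.
Proof.
have H a' b' u v :
    edge (a' * b') u v -> edge (star b' * star a') (flip u) (flip v).
  move=> [uv c]; split; first by move=> /(can_inj flipK).
  have o w : outer (flip w) = flip3 (outer w) by case: w.
  rewrite !o; apply: connected_map c => p q pq; apply: rt_step.
  exact: product_graph_flip.
apply: brauer_graphP => u v; split=> [/H|]; first by rewrite !flipK.
by move=> /H; rewrite !starK.
Qed.

End Star.

Section Products.
Context {X : Type}.
Implicit Types (a b : brauer_graph X) (x y z w : X).

Lemma mul_transversal a b x y z :
  a (inl x) (inr y) -> b (inl y) (inr z) -> edge (a * b) (inl x) (inr z).
Proof.
move=> xy yz; split=> //; apply: (@rt_trans _ _ _ (middle y)); apply: rt_step.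
  by left; exists (inl x), (inr y).
by right; exists (inl y), (inr z).
Qed.

(** If x is in no transversal of a, its component in the product graph contains
    only upper vertices in no transversal of a. *)
Lemma Dom_mul_sub a b : Dom (a * b) `<=` Dom a.
Proof.
move=> x [z [_ c]]; apply: contrapT => nx.
pose P (p : vertex3 X) := if p is upper w then ~ Dom a w else False.
apply: (@connected_invariant _ _ P _ _ _ _ c) => // p q + pq.
case: pq => -[[u|u] [v [uv <- <-]]] //= nu.
case: v uv => v uv /=; last by apply: nu; exists v.
by move=> [w vw]; have := edge_uniq (edge_sym uv) vw.
Qed.

Lemma Codom_mul_sub a b : Codom (a * b) `<=` Codom b.
Proof. by rewrite -!Dom_star star_mul; apply: Dom_mul_sub. Qed.

(** How a transversal of a gets lost in a product: it meets a vertex y which is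
    isolated in b or hooked to some z, and from z the path, if there is one,
    returns to an upper vertex along another transversal of a. *)
Lemma notin_Dom_mul a b x y : a (inl x) (inr y) -> ~ Dom b y ->
  (forall z, b (inl y) (inl z) -> Codom a z) -> ~ Dom (a * b) x.
Proof.
move=> xy ny hy [z [_ c]].
(* P describes the whole component of x, which has at most four vertices. *)
pose P (p : vertex3 X) := [\/ p = upper x, p = middle y |
  exists2 y', b (inl y) (inl y') &
    p = middle y' \/ exists2 w, a (inl w) (inr y') & p = upper w].
suff: P (outer (inr z)) by case=> [//|//|[y' _ [//|[]]]].
apply: (@connected_invariant _ _ P _ _ _ _ c); last by constructor 1.
move=> p q + pq.
case: pq => -[[u|u] [v [uv <- <-]]] /= [] //.
- by move=> [e]; subst u; rewrite (edge_uniq uv xy); constructor 2.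
- move=> [y' yy' [//|[w wy' [e]]]]; subst u; constructor 3; exists y' => //.
  by left; rewrite (edge_uniq uv wy').
- move=> [e]; subst u; constructor 1.
  by rewrite (edge_uniq uv (edge_sym xy)).
- move=> [y' yy' [[e]|[//]]]; subst u; have [w wy'] := hy _ yy'.
  constructor 3; exists y' => //; right.
  by exists w; rewrite ?(edge_uniq uv (edge_sym wy')).
- move=> [e]; subst u; case: v uv => v uv /=; last by case: ny; exists v.
  by constructor 3; exists v => //; left.
- move=> [y' yy' [[e]|[//]]]; subst u; constructor 2.
  by rewrite (edge_uniq uv (edge_sym yy')).
- by move=> [y' _ [//|[//]]].
Qed.

Definition trans_preimage a (B : set X) : set X :=
  [set x | exists2 y, a (inl x) (inr y) & B y].

Lemma card_trans_preimage a (B : set X) : trans_preimage a B #= Codom a `&` B.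
Proof.
rewrite card_eq_le; apply/andP; split.
  apply: (@card_le_rel _ _ _ _ (fun x y => a (inl x) (inr y))).
    by move=> x [y xy By]; exists y => //; split=> //; exists x.
  by move=> x x' y _ _ /edge_sym xy /edge_sym x'y; have [] := edge_uniq xy x'y.
apply: (@card_le_rel _ _ _ _ (fun y x => a (inl x) (inr y))).
  by move=> y [[x xy] By]; exists x => //; exists y.
by move=> y y' x _ _ xy xy'; have [] := edge_uniq xy xy'.
Qed.

Lemma compl_Dom_mul_sub a b :
  ~` Dom (a * b) `<=` ~` Dom a `|` trans_preimage a (~` Dom b).
Proof.
move=> x nx; have [[y xy]|nxa] := pselect (Dom a x); last by left.
right; exists y => //; move=> [z yz]; apply: nx; exists z.
exact: mul_transversal xy yz.
Qed.

Lemma compl_Dom_mulS a b : ~` Dom a `<=` ~` Dom (a * b).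
Proof. exact/subsetC/Dom_mul_sub. Qed.

Lemma compl_Codom_mulS a b : ~` Codom b `<=` ~` Codom (a * b).
Proof. exact/subsetC/Codom_mul_sub. Qed.

Lemma infinite_compl_Dom_mul a b (M : set X) : infinite_set M ->
  M #<= ~` Dom (a * b) -> M #<= ~` Dom a \/ M #<= ~` Dom b.
Proof.
move=> Minf Mab.
have /(infinite_card_le_setU Minf)[|Mt] :=
  card_le_trans Mab (subset_card_le (@compl_Dom_mul_sub a b)); first by left.
right; apply: card_le_trans Mt _.
rewrite (card_le_eql (card_trans_preimage _ _)).
by apply: subset_card_le => y [].
Qed.

Lemma infinite_compl_Codom_mul a b (M : set X) : infinite_set M ->
  M #<= ~` Codom (a * b) -> M #<= ~` Codom a \/ M #<= ~` Codom b.
Proof.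
rewrite -!Dom_star star_mul => Minf /(infinite_compl_Dom_mul Minf).
by case; [right|left].
Qed.

(** The upper defect of b is inherited by ab up to the codefect of a.  Let y be
    in no transversal of b.  Unless y or the vertex hooked to it by b is outside
    the codomain of a, the transversal of a that ends in y is lost in ab. *)
Lemma infinite_compl_Dom_right a b (M : set X) : infinite_set M ->
  M #<= ~` Dom b -> M #<= ~` Dom (a * b) \/ M #<= ~` Codom a.
Proof.
move=> Minf Mb.
pose H := [set y | exists2 z, b (inl y) (inl z) & ~ Codom a z].
pose K := [set y | exists2 x, a (inl x) (inr y) & ~ Dom (a * b) x].
have : ~` Dom b `<=` K `|` (~` Codom a `|` H).
  move=> y ny; have [[x xy]|nCy] := pselect (Codom a y); last by right; left.
  have [Hy|nHy] := pselect (H y); first by right; right.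
  left; exists x => //; apply: notin_Dom_mul xy ny _ => z yz.
  by apply: contrapT => nz; apply: nHy; exists z.
move=> /subset_card_le /(card_le_trans Mb) /(infinite_card_le_setU Minf) [MK|].
  left; apply: card_le_trans MK _.
  apply: (@card_le_rel _ _ _ _ (fun y x => a (inl x) (inr y))).
    by move=> y [x xy nx]; exists x.
  by move=> y y' x _ _ xy xy'; have [] := edge_uniq xy xy'.
move=> /(infinite_card_le_setU Minf) [|MH]; right=> //.
apply: card_le_trans MH _.
apply: (@card_le_rel _ _ _ _ (fun y z => b (inl y) (inl z))).
  by move=> y [z yz nz]; exists z.
by move=> y y' z _ _ /edge_sym yz /edge_sym y'z; have [] := edge_uniq yz y'z.
Qed.

Lemma infinite_compl_Codom_left a b (M : set X) : infinite_set M ->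
  M #<= ~` Codom a -> M #<= ~` Codom (a * b) \/ M #<= ~` Dom b.
Proof.
rewrite -!Dom_star -(Codom_star b) star_mul; exact: infinite_compl_Dom_right.
Qed.

End Products.

(** * Additivity of the index for finite defects *)

Section Index.
Context {X : Type}.
Implicit Types (a b : brauer_graph X) (x y z w : X).

(* The upper ends of the transversals of ab that run through a hook, that is
   through at least three middle vertices.  Their number cancels in the index:
   the same transversals are counted at their lower ends. *)
Let indirect a b := Dom (a * b) `\` trans_preimage a (Dom b).

Let finite_compl_trans_preimage a b :
  finite_set (~` Dom a) -> finite_set (~` Dom b) ->
  finite_set (~` trans_preimage a (Dom b)).
Proof.
move=> fa fb.
apply: (@sub_finite_set _ _ (~` Dom a `|` trans_preimage a (~` Dom b))).
  move=> x nx; have [[y xy]|] := pselect (Dom a x); last by left.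
  by right; exists y => // yb; apply: nx; exists y.
rewrite finite_setU; split=> //.
rewrite (eq_finite_set (card_trans_preimage _ _)).
exact: finite_setIr.
Qed.

Let card_indirect a b : indirect a b #<= indirect (star b) (star a).
Proof.
apply: (@card_le_rel _ _ _ _ (fun x z => edge (a * b) (inl x) (inr z))).
  move=> x [[z xz] nx]; exists z => //; split.
    by rewrite -star_mul Dom_star; exists x.
  move=> [y zy]; rewrite Dom_star => -[w wy]; apply: nx.
  have wz := mul_transversal wy (edge_sym zy).
  have [<-] := edge_uniq (edge_sym wz) (edge_sym xz).
  by exists y => //; exists z; apply: edge_sym.
by move=> x x' z _ _ /edge_sym xz /edge_sym x'z; have [] := edge_uniq xz x'z.
Qed.

Let fincard_compl_Dom_mul a b :
  finite_set (~` Dom a) -> finite_set (~` Dom b) ->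
  (fincard (~` Dom (a * b)%g) + fincard (indirect a b) =
   fincard (~` Dom a) + fincard (~` Dom b `\` ~` Codom a))%N.
Proof.
move=> fa fb; have fS := finite_compl_trans_preimage fa fb.
pose S := trans_preimage a (Dom b).
have H A : A `<=` ~` S ->
    fincard (~` S) = (fincard A + fincard (~` S `\` A))%N.
  move=> AS; rewrite (fincard_split A fS).
  by congr (fincard _ + _)%N; apply/setIidPr.
transitivity (fincard (~` S)).
  rewrite (H (~` Dom (a * b))).
    by congr (_ + fincard _)%N; rewrite /indirect !setDE setCK setIC.
  move=> x nx [y xy [z yz]]; apply: nx; exists z; exact: mul_transversal xy yz.
rewrite (H (~` Dom a)); last by move=> x nx [y xy _]; apply: nx; exists y.
congr (_ + _)%N; transitivity (fincard (Codom a `&` ~` Dom b)); last first.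
  by rewrite setDE setCK setIC.
rewrite -(eq_fincard _ (card_trans_preimage a (~` Dom b))); last first.
  rewrite (eq_finite_set (card_trans_preimage _ _)); exact: finite_setIr.
congr fincard; apply/seteqP; split=> x.
  move=> [nx]; rewrite /= notK => -[y xy]; exists y => // yb.
  by apply: nx; exists y.
move=> [y xy ny]; split; last by rewrite /= notK; exists y.
by move=> [y' xy' y'b]; have [e] := edge_uniq xy xy'; apply: ny; rewrite e.
Qed.

(** The index def - codef is additive, stated without subtraction.  Both
    def (ab) and codef (ab) differ from the sums of the defects of the factors by
    the number of indirect transversals plus the number of middle vertices
    that are in no transversal on either side. *)
Lemma index_mul a b :
  finite_set (~` Dom a) -> finite_set (~` Codom a) ->
  finite_set (~` Dom b) -> finite_set (~` Codom b) ->
  (fincard (~` Dom (a * b)%g) + (fincard (~` Codom a) + fincard (~` Codom b)) =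
   fincard (~` Codom (a * b)%g) + (fincard (~` Dom a) + fincard (~` Dom b)))%N.
Proof.
move=> fa fa' fb fb'.
have E := fincard_compl_Dom_mul fa fb.
have := @fincard_compl_Dom_mul (star b) (star a).
rewrite -star_mul !Dom_star Codom_star => /(_ fb' fa') E'.
have fI : finite_set (indirect a b).
  by apply: sub_finite_set (finite_compl_trans_preimage fa fb) => x [].
have : indirect a b #= indirect (star b) (star a).
  rewrite card_eq_le card_indirect /=.
  by have := card_indirect (star b) (star a); rewrite !starK.
move=> /(eq_fincard fI) EI.
have := fincard_split (~` Codom a) fb; have := fincard_split (~` Dom b) fa'.
rewrite (setIC (~` Codom a)); lia.
Qed.

End Index.

(** * Elements with codefect at most the defect *)

Section Stability.
Context {X : Type}.
Implicit Types (a b e : brauer_graph X).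

Definition codef_le_def : set (brauer_graph X) :=
  [set a | ~` Codom a #<= ~` Dom a].

(** The defect of b is finite because an infinite one would reappear in the
    defect of ab or in the codefect of a. *)
Lemma finite_defects_factors a b : codef_le_def a ->
  finite_set (~` Dom (a * b)) -> finite_set (~` Codom (a * b)) ->
  [/\ finite_set (~` Dom a), finite_set (~` Codom a),
    finite_set (~` Dom b) & finite_set (~` Codom b)].
Proof.
move=> la fd fc.
have fa : finite_set (~` Dom a) := sub_finite_set (@compl_Dom_mulS _ a b) fd.
have fa' : finite_set (~` Codom a) := card_le_finite la fa.
split=> //; last exact: sub_finite_set (@compl_Codom_mulS _ a b) fc.
apply: contrapT => inf.
by have [/card_le_finite/(_ fd)|/card_le_finite/(_ fa')] :=
  infinite_compl_Dom_right a inf (card_lexx _).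
Qed.

(** If codef (ab) is infinite, it is at most codef a or codef b; the former is
    at most def a, hence at most def (ab), and the latter at most def b, which
    survives in def (ab) up to codef a.  The case of finite defects is the
    additivity of the index. *)
Lemma codef_le_def_mul a b :
  codef_le_def a -> codef_le_def b -> codef_le_def (a * b).
Proof.
move=> la lb; rewrite /codef_le_def /=.
have aab := card_le_trans la (subset_card_le (@compl_Dom_mulS _ a b)).
have [fin|inf] := pselect (finite_set (~` Codom (a * b))); last first.
  have [aM|bM] := infinite_compl_Codom_mul inf (card_lexx _).
    exact: card_le_trans aM aab.
  have [//|aM] := infinite_compl_Dom_right a inf (card_le_trans bM lb).
  exact: card_le_trans aM aab.
have [fin'|] := pselect (finite_set (~` Dom (a * b))); last first.
  exact: card_le_finite_infinite.
have [fa fa' fb fb'] := finite_defects_factors la fin' fin.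
have := index_mul fa fa' fb fb'; move: la lb.
rewrite /codef_le_def /= !card_le_fincard //; lia.
Qed.

(** Let y be in no transversal of an idempotent e.  If y is the lower end of a
    transversal {x, y'}, it would be lost in ee = e unless y were hooked to
    a vertex outside the codomain.  So def e is at most twice codef e, which
    settles the infinite case; in the finite case the index of e is twice
    itself. *)
Lemma idempotent_def_le_codef e : e * e = e -> ~` Dom e #<= ~` Codom e.
Proof.
move=> ee.
have [fd|inf] := pselect (finite_set (~` Dom e)); last first.
  pose H := [set y | exists2 z, e (inl y) (inl z) & ~ Codom e z].
  have : ~` Dom e `<=` ~` Codom e `|` H.
    move=> y ny; have [[x xy]|nCy] := pselect (Codom e y); last by left.
    right; apply: contrapT => nHy.
    suff : ~ Dom (e * e) x by rewrite ee; apply; exists y.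
    apply: notin_Dom_mul xy ny _ => z yz.
    by apply: contrapT => nz; apply: nHy; exists z.
  move=> /subset_card_le /(infinite_card_le_setU inf) [//|] eH.
  apply: card_le_trans eH _.
  apply: (@card_le_rel _ _ _ _ (fun y z => e (inl y) (inl z))).
    by move=> y [z yz nz]; exists z.
  by move=> y y' z _ _ /edge_sym yz /edge_sym y'z; have [] := edge_uniq yz y'z.
have [fc|] := pselect (finite_set (~` Codom e)); last first.
  exact: card_le_finite_infinite.
by have := index_mul fd fc fd fc; rewrite ee card_le_fincard //; lia.
Qed.

Lemma idempotent_codef_le_def e : e * e = e -> ~` Codom e #<= ~` Dom e.
Proof.
move=> ee; rewrite -(Codom_star e) -Dom_star.
by apply: idempotent_def_le_codef; rewrite -star_mul ee.
Qed.

Lemma Dom1 : Dom (1 : brauer_graph X) = setT.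
Proof. by apply/seteqP; split=> // x _; exists x, x; left. Qed.

Lemma Codom1 : Codom (1 : brauer_graph X) = setT.
Proof. by apply/seteqP; split=> // x _; exists x, x; left. Qed.

Lemma left_unit_Codom a : @left_units (brauer_graph X) a -> ~` Codom a = set0.
Proof.
move=> [b ba]; rewrite -subset0 -setCT -Codom1 -ba.
exact: compl_Codom_mulS.
Qed.

Lemma right_unit_Dom a b : a * b = 1 -> ~` Dom a = set0.
Proof.
move=> ab; rewrite -subset0 -setCT -Dom1 -ab.
exact: compl_Dom_mulS.
Qed.

Lemma FL_codef_le_def : FL X `<=` codef_le_def.
Proof.
apply: smallest_sub; first exact: codef_le_def_mul.
move=> a [/idempotent_codef_le_def//|/left_unit_Codom a0].
by rewrite /codef_le_def /= a0; apply: card_ge0.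
Qed.

Lemma F_def_eq_codef : F X `<=` [set a | ~` Dom a #= ~` Codom a].
Proof.
move=> a Fa; rewrite /= card_eq_le; apply/andP.
suff: codef_le_def (star a) /\ codef_le_def a.
  by rewrite /codef_le_def /= Codom_star Dom_star.
pose D : set (brauer_graph X) :=
  [set b | codef_le_def (star b) /\ codef_le_def b].
have FD : F X `<=` D.
  apply: smallest_sub => [b c [sb lb] [sc lc]|b [bb|[[c cb] [c' bc']]]].
  - by split; rewrite ?star_mul; apply: codef_le_def_mul.
  - split; last exact: idempotent_codef_le_def.
    by apply: idempotent_codef_le_def; rewrite -star_mul bb.
  - rewrite /D /codef_le_def /= Codom_star (right_unit_Dom bc').
    by rewrite (@left_unit_Codom b) //; exists c.
exact: FD.
Qed.

End Stability.

(** * Products without long paths *)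

Section Separated.
Context {X : Type}.
Implicit Types (a b c : brauer_graph X).

(** No hook of one factor meets an edge of the other one in the middle layer.
    Then all paths of the product graph have at most two edges, and the product
    can be read off. *)
Definition separated a b :=
  (forall y y' u, a (inr y) (inr y') -> ~ b (inl y) u) /\
  (forall y y' u, b (inl y) (inl y') -> ~ a (inr y) u).

Definition separated_edge a b (u v : X + X) : Prop :=
  match u, v with
  | inl x, inl x' => a (inl x) (inl x')
  | inl x, inr z => exists2 y, a (inl x) (inr y) & b (inl y) (inr z)
  | inr z, inl x => exists2 y, a (inl x) (inr y) & b (inl y) (inr z)
  | inr z, inr z' => b (inr z) (inr z')
  end.

Lemma separated_star a b : separated a b -> separated (star b) (star a).
Proof. by move=> [sa sb]; split=> y y' u /= e; [apply: sb e|apply: sa e]. Qed.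

Lemma mul_upper_hook a b x x' :
  a (inl x) (inl x') -> edge (a * b) (inl x) (inl x').
Proof.
move=> xx'; split; first by move=> e; move: xx'; rewrite e; apply: edge_irrefl.
by apply: rt_step; left; exists (inl x), (inl x').
Qed.

Lemma mul_lower_hook a b z z' :
  b (inr z) (inr z') -> edge (a * b) (inr z) (inr z').
Proof.
move=> zz'; rewrite -(starK (a * b)) star_mul.
exact: (@mul_upper_hook (star b) (star a)).
Qed.

Let mul_separated_inl a b x v : separated a b ->
  edge (a * b) (inl x) v -> separated_edge a b (inl x) v.
Proof.
move=> [sa sb] [xv c].
pose P (p : vertex3 X) := match p with
  | upper w => w = x \/ a (inl x) (inl w)
  | middle y => a (inl x) (inr y)
  | lower z => exists2 y, a (inl x) (inr y) & b (inl y) (inr z)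
  end.
(* P describes the component of the upper vertex x. *)
suff: P (outer v) by case: v xv {c} => [w|z] //= xv [e|//]; case: xv; rewrite e.
apply: (@connected_invariant _ _ P _ _ _ _ c); last by left.
move=> p q + pq; case: pq => -[[u|u] [v' [uv <- <-]]] /=.
- move=> [e|xu]; first by subst u; case: v' uv; [right|].
  by rewrite (edge_uniq uv (edge_sym xu)); left.
- by move=> xu; rewrite (edge_uniq uv (edge_sym xu)); left.
- move=> xu; case: v' uv => [y'|z] uv /=; last by exists u.
  by case: (sb _ _ _ uv (edge_sym xu)).
- by move=> [y xy yz]; rewrite (edge_uniq uv (edge_sym yz)).
Qed.

Lemma mul_separated a b u v : separated a b ->
  (edge (a * b) u v <-> separated_edge a b u v).
Proof.
move=> s; split; last first.
  case: u v => [x|z] [x'|z'] /=.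
  - exact: mul_upper_hook.
  - by move=> [y]; apply: mul_transversal.
  - move=> [y xy yz]; apply: (@edge_sym _ (a * b)).
    exact: mul_transversal xy yz.
  - exact: mul_lower_hook.
case: u => [x|z]; first exact: mul_separated_inl.
rewrite -(starK (a * b)) star_mul => /(mul_separated_inl (separated_star s)).
by case: v => [x|z'] //= -[y zy yx]; exists y; apply: edge_sym.
Qed.

End Separated.

(** * Factorization of graphs, and the elements of F and FL *)

Section Constructions.
Context {X : Type}.
Implicit Types (a b c : brauer_graph X) (g h k : X -> X).

(** The upper hooks of a together with the identity on its domain, without lower
    hooks: an idempotent that carries the upper hooks of a. *)
Definition upper_part_edge a (u v : X + X) : Prop :=
  match u, v with
  | inl x, inl y => a (inl x) (inl y)
  | inl x, inr y => x = y /\ Dom a x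
  | inr x, inl y => x = y /\ Dom a x
  | inr x, inr y => False
  end.

Lemma upper_part_irrefl a u : ~ upper_part_edge a u u.
Proof. by case: u => [x|x] //=; apply: edge_irrefl. Qed.

Lemma upper_part_sym a u v : upper_part_edge a u v -> upper_part_edge a v u.
Proof.
by case: u v => [x|x] [y|y] //=; [exact: edge_sym|move=> [<-]|move=> [<-]].
Qed.

Lemma hook_notin_Dom a x y : a (inl x) (inl y) -> ~ Dom a x.
Proof. by move=> xy [z xz]; have := edge_uniq xy xz. Qed.

Lemma upper_part_uniq a u v w :
  upper_part_edge a u v -> upper_part_edge a u w -> v = w.
Proof.
case: u v w => [x|x] [y|y] [z|z] //=.
- exact: edge_uniq.
- by move=> /hook_notin_Dom nx [_ /nx].
- by move=> [_ dx] /hook_notin_Dom.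
- by move=> [<- _] [<-].
- by move=> [<- _] [<-].
Qed.

Definition upper_part a : brauer_graph X :=
  BrauerGraph (@upper_part_irrefl a) (@upper_part_sym a) (@upper_part_uniq a).

Lemma upper_part_idem a : upper_part a * upper_part a = upper_part a.
Proof.
have s : separated (upper_part a) (upper_part a).
  split=> [y y' u []|y y' [u|u]] //= /hook_notin_Dom ny; last by case.
  by move=> [_ /ny].
apply: brauer_graphP => u v; rewrite mul_separated //.
case: u v => [x|x] [y|y] //=; split=> [[z [-> dx] [-> _]]//|[<- dx]];
  by exists x.
Qed.

(** The transversals are {g y, y'}, so that composition of injections becomes
    the product of graphs, and every lower vertex is in a transversal. *)
Definition inj_edge g (u v : X + X) : Prop :=
  match u, v with
  | inl x, inr y => x = g y
  | inr y, inl x => x = g y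
  | _, _ => False
  end.

Lemma inj_graph_irrefl g u : ~ inj_edge g u u.
Proof. by case: u => x /=. Qed.

Lemma inj_graph_sym g u v : inj_edge g u v -> inj_edge g v u.
Proof. by case: u v => [x|x] [y|y] /=. Qed.

Lemma inj_graph_uniq g : injective g ->
  forall u v w, inj_edge g u v -> inj_edge g u w -> v = w.
Proof.
move=> gI [x|x] [y|y] [z|z] //=; first by move=> -> /gI ->.
by move=> -> ->.
Qed.

Definition inj_graph g (gI : injective g) : brauer_graph X :=
  BrauerGraph (@inj_graph_irrefl g) (@inj_graph_sym g) (inj_graph_uniq gI).

Lemma Dom_inj_graph g (gI : injective g) : Dom (inj_graph gI) = range g.
Proof.
by apply/seteqP; split=> x [y]; [move=> ->; exists y|move=> _ <-; exists y].
Qed.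

Lemma Codom_inj_graph g (gI : injective g) : Codom (inj_graph gI) = setT.
Proof. by apply/seteqP; split=> // y _; exists (g y). Qed.

Lemma inj_graph_comp g h k
    (gI : injective g) (hI : injective h) (kI : injective k) :
  (forall y, k y = g (h y)) -> inj_graph kI = inj_graph gI * inj_graph hI.
Proof.
move=> kE; apply: brauer_graphP => u v; rewrite mul_separated; last by split.
case: u v => [x|x] [y|y] //=; rewrite kE; split=> [->|[z -> ->] //];
  by eexists.
Qed.

Lemma inj_graph_id (idI : injective (@id X)) : inj_graph idI = 1.
Proof.
apply: brauer_graphP => u v; case: u v => [x|x] [y|y]; split=> //=.
- by case=> z [] [].
- by move=> ->; exists y; left.
- by case=> z [] [] // [->] [->].
- by move=> ->; exists x; right.
- by case=> z [] [] // [->] [->].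
- by case=> z [] [].
Qed.

Lemma inj_graph_left_unit g (gI : injective g) :
  @left_units (brauer_graph X) (inj_graph gI).
Proof.
exists (star (inj_graph gI)); rewrite -(inj_graph_id (fun x y e => e)).
apply: brauer_graphP => u v; rewrite mul_separated; last by split.
by case: u v => [x|x] [y|y] //=; split=> [[z -> /gI ->]|->] //;
  [exists (g y)|exists (g x)].
Qed.

Lemma inj_graph_unit g (gI : injective g) : (forall x, exists y, x = g y) ->
  @units (brauer_graph X) (inj_graph gI).
Proof.
move=> gS; split; first exact: inj_graph_left_unit.
exists (star (inj_graph gI)); rewrite -(inj_graph_id (fun x y e => e)).
apply: brauer_graphP => u v; rewrite mul_separated; last by split.
by case: u v => [x|x] [y|y] //=; split=> [[z -> ->]|->] //;
  [have [z xz] := gS y|have [z xz] := gS x]; exists z.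
Qed.

(** Outside the codomain of c the values of g do not matter: the transversals of
    the middle factor starting there are cut by the lower idempotent. *)
Lemma factorization c g (gI : injective g) :
  (forall x y, c (inl x) (inr y) -> x = g y) ->
  c = upper_part c * inj_graph gI * star (upper_part (star c)).
Proof.
move=> cg; have s1 : separated (upper_part c) (inj_graph gI) by split.
have s2 : separated (upper_part c * inj_graph gI) (star (upper_part (star c))).
  by split=> // y y' u /(mul_separated _ _ s1).
have H x z : c (inl x) (inr z) <-> exists2 y,
    edge (upper_part c * inj_graph gI) (inl x) (inr y) &
    star (upper_part (star c)) (inl y) (inr z).
  split=> [xz|[y /(mul_separated _ _ s1)[w [<- _]] /= -> []]].
    exists z; last by split=> //; rewrite Dom_star; exists x.
    by apply/(mul_separated _ _ s1); exists x; [split=> //; exists z|apply: cg].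
  by rewrite Dom_star => <- [x' x'y]; rewrite -(cg _ _ x'y).
apply: brauer_graphP => u v; rewrite mul_separated //.
case: u v => [x|x] [y|y]; rewrite /separated_edge.
- by rewrite mul_separated.
- exact: H.
- by rewrite -H; split; apply: edge_sym.
- by [].
Qed.

(** Removes the upper hooks of a left unit b, where k sends each lower vertex to
    the upper end of its transversal. *)
Lemma inj_graph_of_left_unit b k (kI : injective k) :
  (forall y, b (inl (k y)) (inr y)) ->
  inj_graph kI = upper_part (inj_graph kI) * b.
Proof.
move=> kb; have s : separated (upper_part (inj_graph kI)) b.
  split=> [y y' u [] //|y y' [u|u] yy' []] _; rewrite Dom_inj_graph => -[z _ zy].
  by move: yy'; rewrite -zy => yy'; have := edge_uniq yy' (kb z).
have H x z : x = k z <->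
    exists2 y, upper_part (inj_graph kI) (inl x) (inr y) & b (inl y) (inr z).
  split=> [->|[y [<- _] xz]].
    by exists (k z) => //; split=> //; rewrite Dom_inj_graph; exists z.
  by have [] := edge_uniq (edge_sym xz) (edge_sym (kb z)).
apply: brauer_graphP => u v; rewrite mul_separated //.
case: u v => [x|x] [y|y]; rewrite /separated_edge //; try exact: H.
by split=> [[]|xy]; have := edge_uniq xy (edge_sym (kb x)).
Qed.

End Constructions.

Section Characterization.
Context {X : Type}.
Implicit Types (a b c : brauer_graph X) (g h k : X -> X).

Lemma generated_mul (S : semigroupType) (U : set S) x y :
  generated U x -> generated U y -> generated U (x * y).
Proof. by move=> Ux Uy D DU; apply: DU.1; [apply: Ux|apply: Uy]. Qed.

Lemma extend_partner c (j : X -> X) :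
  (forall y, ~ Codom c y -> ~ Dom c (j y)) ->
  (forall y y', ~ Codom c y -> ~ Codom c y' -> j y = j y' -> y = y') ->
  exists g, [/\ injective g, forall x y, c (inl x) (inr y) -> x = g y &
    forall y, ~ Codom c y -> g y = j y].
Proof.
move=> jD jI.
have /choice[g gP] : forall y, exists x,
    c (inl x) (inr y) \/ ~ Codom c y /\ x = j y.
  move=> y; have [[x xy]|ny] := pselect (Codom c y); first by exists x; left.
  by exists (j y); right.
exists g; split=> [y y' e|x y xy|y ny].
- have := gP y'; have := gP y; rewrite -e => -[gy|[ny gj]] [gy'|[ny' gj']].
  + by have [] := edge_uniq gy gy'.
  + by case: (jD _ ny'); rewrite -gj'; exists y.
  + by case: (jD _ ny); rewrite -gj; exists y'.
  + by apply: jI => //; rewrite -gj -gj'.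
- case: (gP y) => [gy|[ny _]]; last by case: ny; exists x.
  by have [] := edge_uniq (edge_sym xy) (edge_sym gy).
- by case: (gP y) => [gy|[_ //]]; case: ny; exists (g y).
Qed.

Lemma codef_le_def_factor c : codef_le_def c ->
  exists g (gI : injective g),
    c = upper_part c * inj_graph gI * star (upper_part (star c)).
Proof.
move=> lc; have [[x0 _]|nX] := pselect (exists x : X, True); last first.
  by exists id, (fun x y e => e); apply: factorization => x; case: nX; exists x.
have [j [jD jI]] := card_le_injP x0 lc.
have [g [gI cg _]] := extend_partner jD jI.
by exists g, gI; apply: factorization.
Qed.

Lemma idem_F a : a * a = a -> F X a.
Proof. by move=> aa; apply: sub_gen_smallest; left. Qed.

Lemma unit_F a : @units (brauer_graph X) a -> F X a.
Proof. by move=> ua; apply: sub_gen_smallest; right. Qed.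

Lemma F_mul a b : F X a -> F X b -> F X (a * b).
Proof. exact: generated_mul. Qed.

Lemma FL_mul a b : FL X a -> FL X b -> FL X (a * b).
Proof. exact: generated_mul. Qed.

Lemma star_upper_part_idem a :
  star (upper_part a) * star (upper_part a) = star (upper_part a).
Proof. by rewrite -star_mul upper_part_idem. Qed.

Lemma def_eq_codef_F c : ~` Dom c #= ~` Codom c -> F X c.
Proof.
move=> /card_esym e.
have [[x0 _]|nX] := pselect (exists x : X, True); last first.
  apply: idem_F; apply: brauer_graphP => u; case: nX.
  by exists (match u with inl x => x | inr x => x end).
have [j [jD jI jS]] := card_eq_bijP x0 e.
have [g [gI cg gj]] := extend_partner jD jI.
rewrite (factorization gI cg); apply: F_mul; [apply: F_mul|].
- exact: idem_F (upper_part_idem c).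
- apply: unit_F; apply: inj_graph_unit => x.
  have [[y xy]|nx] := pselect (Dom c x).
    by exists y; apply: cg.
  by have [y ny <-] := jS _ nx; exists y; rewrite gj.
- exact: idem_F (star_upper_part_idem _).
Qed.

Lemma codef_le_def_FL c : codef_le_def c -> FL X c.
Proof.
move=> /codef_le_def_factor[g [gI ->]]; apply: FL_mul; [apply: FL_mul|];
  apply: sub_gen_smallest; [left|right|left].
- exact: upper_part_idem.
- exact: inj_graph_left_unit.
- exact: star_upper_part_idem.
Qed.

End Characterization.

(** * Drops *)

Section Drops.
Context {X : Type}.
Implicit Types (a b : brauer_graph X) (M : set X).

(** Here M stands for its cardinal: the codefect of a is smaller than the
    cardinal of M, which is the defect of a. *)
Definition drops M a := ~` Dom a #= M /\ ~~ (M #<= ~` Codom a).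

(** Let mu be the cardinal of M.  If codef a < mu, then mu is at most def a,
    and a drops, or at most def b; in the latter case def b = mu, because a larger
    defect would survive in ab.  If codef a = mu, it survives in codef (ab), which
    is smaller than mu, unless def b absorbs it; so again def b = mu, and
    codef b <= codef (ab) < mu. *)
Lemma drops_mul_infinite M a b : infinite_set M -> codef_le_def a ->
  drops M (a * b) -> drops M a \/ drops M b.
Proof.
move=> Minf la [DM /negP nMC].
have DabM : ~` Dom (a * b) #<= M by move: DM => /card_eqPle[].
have MDab : M #<= ~` Dom (a * b) by move: DM => /card_eqPle[].
have Daab := subset_card_le (@compl_Dom_mulS _ a b).
have nMb : ~~ (M #<= ~` Codom b).
  by apply/negP => /card_le_trans /(_ (subset_card_le (@compl_Codom_mulS _ a b))).
have bM : ~` Codom a #<= M -> M #<= ~` Dom b -> drops M b.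
  move=> CaM Mb; split=> //; apply/card_eqPle; split=> //.
  have binf : infinite_set (~` Dom b) by move=> /(card_le_finite Mb).
  have [bD|bC] := infinite_compl_Dom_right a binf (card_lexx _).
    exact: card_le_trans bD DabM.
  exact: card_le_trans bC CaM.
have CaM : ~` Codom a #<= M := card_le_trans la (card_le_trans Daab DabM).
have [MCa|/negP nMCa] := pselect (M #<= ~` Codom a).
  right; apply: bM => //.
  by have [//|//] := infinite_compl_Codom_left b Minf MCa.
have [MDa|MDb] := infinite_compl_Dom_mul Minf MDab.
  left; split=> //; apply/card_eqPle; split=> //.
  exact: card_le_trans Daab DabM.
by right; apply: bM.
Qed.

Lemma drops_fincard M a : finite_set M -> fincard M = 1%N ->
  finite_set (~` Dom a) -> finite_set (~` Codom a) ->
  drops M a <-> fincard (~` Dom a) = 1%N /\ fincard (~` Codom a) = 0.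
Proof.
move=> fM M1 fd fc.
rewrite /drops card_eq_fincard // card_le_fincard // M1 -ltnNge.
by split=> [[/eqP -> ]|[-> ->]] //; case: fincard.
Qed.

(** All defects are finite, so the index of ab, which is 1, is the sum of the
    non-negative indices of a and b; since def a <= 1 and codef b = 0, the factor
    of index 1 drops. *)
Lemma drops_mul_unit M a b : finite_set M -> fincard M = 1%N ->
  codef_le_def a -> codef_le_def b ->
  drops M (a * b) -> drops M a \/ drops M b.
Proof.
move=> fM M1 la lb dab.
have fd : finite_set (~` Dom (a * b)) by rewrite (eq_finite_set dab.1).
have fc : finite_set (~` Codom (a * b)).
  exact: card_le_finite (codef_le_def_mul la lb) fd.
have [fa fa' fb fb'] := finite_defects_factors la fd fc.
move: dab; rewrite !drops_fincard // => -[d1 c0].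
have := index_mul fa fa' fb fb'; rewrite d1 c0.
have := subset_card_le (@compl_Codom_mulS _ a b); rewrite card_le_fincard // c0.
have := subset_card_le (@compl_Dom_mulS _ a b); rewrite card_le_fincard // d1.
move: la; rewrite /codef_le_def /= card_le_fincard //; lia.
Qed.

(** The cardinals mu > 0 that are not the sum of two smaller ones: these are 1
    and the infinite ones. *)
Definition indecomposable M := infinite_set M \/ finite_set M /\ fincard M = 1%N.

Lemma drops_mul M a b : indecomposable M -> codef_le_def a -> codef_le_def b ->
  drops M (a * b) -> drops M a \/ drops M b.
Proof.
by move=> [Minf|[fM M1]] la lb; [apply: drops_mul_infinite|apply: drops_mul_unit].
Qed.

Lemma indecomposable_neq0 M : indecomposable M -> ~~ (M #<= @set0 X).
Proof.
move=> sM; apply/negP => /card_le0P M0; move: sM; rewrite M0 => -[[]|[_]].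
  exact: finite_set0.
by rewrite /fincard fset_set0.
Qed.

Lemma drops_inj_graph M g (gI : injective g) :
  indecomposable M -> ~` range g #= M -> drops M (inj_graph gI).
Proof.
move=> sM gM; split; first by rewrite Dom_inj_graph.
by rewrite Codom_inj_graph setCT; apply: indecomposable_neq0.
Qed.

Lemma inj_graph_FL g (gI : injective g) : FL X (inj_graph gI).
Proof. by apply: sub_gen_smallest; right; apply: inj_graph_left_unit. Qed.

Lemma F_FL : F X `<=` FL X.
Proof.
by move=> a /F_def_eq_codef /= /card_eqPle[_ h]; apply: codef_le_def_FL.
Qed.

Lemma generated_FL (U : set (brauer_graph X)) : U `<=` FL X ->
  generated (F X `|` U) `<=` FL X.
Proof.
move=> UFL; apply: smallest_sub => [a b|a [/F_FL//|/UFL//]]; exact: FL_mul.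
Qed.

(** The elements of FL without a drop at M form a subsemigroup containing F, and
    a proper one: some left unit drops at M. *)
Lemma drops_necessary (U : set (brauer_graph X)) M : infinite_set [set: X] ->
  U `<=` FL X -> FL X = generated (F X `|` U) -> indecomposable M ->
  exists2 a, U a & drops M a.
Proof.
move=> Xinf UFL FLU sM; apply: contrapT => nU.
have [g gI gM] := inj_compl_range M Xinf.
have : FL X `<=` [set a | codef_le_def a /\ ~ drops M a].
  rewrite FLU; apply: smallest_sub => [a b [la na] [lb nb]|a [Fa|Ua]].
  - by split; [apply: codef_le_def_mul|move=> /(drops_mul sM la lb)[]].
  - split; first exact: FL_codef_le_def (F_FL Fa).
    move=> [DM /negP]; apply; move: (F_def_eq_codef Fa) => /= E.
    by have /card_eqPle[] := card_eq_trans (card_esym DM) E.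
  - by split; [exact: FL_codef_le_def (UFL _ Ua)|move=> da; apply: nU; exists a].
move=> /(_ _ (inj_graph_FL gI))[_]; apply; exact: drops_inj_graph.
Qed.

(** The product of a and the graph of g is a left unit; after removing its upper
    hooks it is the graph of an injection k whose range has a complement of the
    size of M, and h arises from k by a permutation of X. *)
Lemma generated_inj_graph_of_drops (U : set (brauer_graph X)) M a
    g (gI : injective g) h (hI : injective h) :
  drops M a -> range g = Codom a -> ~` range h #= M ->
  generated (F X `|` U) a -> generated (F X `|` U) (inj_graph gI) ->
  generated (F X `|` U) (inj_graph hI).
Proof.
move=> [DM _] gC hM Ga Gg.
have GF c : F X c -> generated (F X `|` U) c.
  by move=> Fc; apply: sub_gen_smallest; left.
have /choice[k kP] : forall y, exists x, a (inl x) (inr (g y)).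
  by move=> y; have : range g (g y) by [exists y]; rewrite gC.
have kb y : edge (a * inj_graph gI) (inl (k y)) (inr y).
  exact: mul_transversal (kP y) _.
have kI : injective k.
  move=> y y' e; have := kb y'; rewrite -e => /edge_uniq /(_ (kb y)) [].
  by [].
have kD : range k = Dom a.
  apply/seteqP; split=> [x [y _ <-]|x [z xz]]; first by exists (g y).
  have [y _ yz] : range g z by rewrite gC; exists x.
  exists y => //; move: (kP y); rewrite yz => yz'.
  by have [] := edge_uniq (edge_sym yz') (edge_sym xz).
have [p [pI pS] hp] : exists2 p : X -> X,
    injective p /\ (forall x, exists y, x = p y) & forall y, h y = p (k y).
  apply: eq_compl_range_perm => //; rewrite kD.
  by rewrite (card_eql hM) card_eq_sym.
rewrite (inj_graph_comp pI kI hI hp); apply: generated_mul.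
  exact: GF (unit_F (inj_graph_unit pI pS)).
rewrite (inj_graph_of_left_unit kI kb); apply: generated_mul.
  exact: GF (idem_F (upper_part_idem _)).
exact: generated_mul.
Qed.

(** Well-founded induction on the size of the complement of the range of an
    injection. *)
Lemma drops_sufficient (U : set (brauer_graph X)) : infinite_set [set: X] ->
  (forall M, indecomposable M -> exists2 a, U a & drops M a) ->
  FL X `<=` generated (F X `|` U).
Proof.
move=> Xinf HU.
have GF c : F X c -> generated (F X `|` U) c.
  by move=> Fc; apply: sub_gen_smallest; left.
have GU c : U c -> generated (F X `|` U) c.
  by move=> Uc; apply: sub_gen_smallest; right.
suff injG M g (gI : injective g) :
    ~` range g #= M -> generated (F X `|` U) (inj_graph gI).
  move=> c /FL_codef_le_def/codef_le_def_factor[g [gI ->]].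
  apply: generated_mul; [apply: generated_mul|].
  - exact: GF (idem_F (upper_part_idem _)).
  - exact: injG (card_eqxx _).
  - exact: GF (idem_F (star_upper_part_idem _)).
move: M g gI; apply: card_lt_ind => M IH g gI gM.
(* The codomain of a has a smaller complement than M, hence the size of X, and
   the induction hypothesis applies to an injection onto it. *)
have indecG : indecomposable M -> generated (F X `|` U) (inj_graph gI).
  move=> sM; have [a Ua aM] := HU _ sM.
  have [k kI kC] : exists2 k : X -> X, injective k & range k = Codom a.
    apply: inj_range.
    have : [set: X] #<= Codom a `|` ~` Codom a by rewrite setUv.
    move=> /(infinite_card_le_setU Xinf) [//|XC].
    by case: aM => _ /negP[]; apply: card_le_trans XC; apply: card_leT.
  apply: (generated_inj_graph_of_drops (gI := kI) gI aM kC gM (GU _ Ua)).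
  by apply: (IH (~` Codom a)); [case: aM|rewrite kC].
have [fM|Minf] := pselect (finite_set M); last by apply: indecG; left.
have [g0|] := pselect (exists x, ~ range g x); last first.
  move=> ng; apply: GF; apply: unit_F; apply: inj_graph_unit => x.
  have [y _ yx] : range g x by apply: contrapT => nx; apply: ng; exists x.
  by exists y.
have [a0 na0] := g0.
have fg : finite_set (~` range g) by rewrite (eq_finite_set gM).
have cgM : fincard (~` range g) = fincard M by apply: eq_fincard.
have := fincard_split [set a0] fg.
have -> : ~` range g `&` [set a0] = [set a0].
  by apply/seteqP; split=> x [] // ->.
rewrite fincard_set1 cgM => cM.
have [M1|M1] := eqVneq (fincard M) 1%N; first by apply: indecG; right.
(* M is finite with at least two elements: g factors through an injection s
   missing only the point a0, and both factors miss fewer points than g. *)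
have [s sI sR] : exists2 s : X -> X, injective s & range s = ~` [set a0].
  apply: inj_range.
  have : [set: X] #<= ~` [set a0] `|` [set a0] by rewrite setUC setUv.
  move=> /(infinite_card_le_setU Xinf) [//|] /card_le_finite Xa.
  by case: Xinf; apply: Xa; apply: finite_set1.
have /choice[k kP] : forall y, exists y', g y = s y'.
  move=> y; have [y' _ <-] : range s (g y); last by exists y'.
  by rewrite sR => e; apply: na0; rewrite -e; exists y.
have kI : injective k by move=> y y' e; apply: (gI); rewrite !kP e.
have kM : ~` range k #= ~` range g `\` [set a0].
  rewrite card_eq_le; apply/andP; split.
    apply: (@card_le_inj _ _ _ _ s) => [x nx|x y _ _ /sI//]; split.
      by move=> [y _]; rewrite kP => /sI e; apply: nx; exists y.
    by have : range s (s x) by [exists x]; rewrite sR.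
  apply: (@card_le_rel _ _ _ _ (fun x w => s w = x)); last first.
    by move=> x x' w _ _ <-.
  move=> x [nx xa].
  have [w _ wx] : range s x by rewrite sR.
  by exists w => // -[y _ yw]; apply: nx; exists y => //; rewrite kP yw.
rewrite (inj_graph_comp sI kI gI kP); apply: generated_mul.
  apply: (IH [set a0]); last by rewrite sR setCK.
  by rewrite card_le_fincard ?fincard_set1 //; lia.
apply: IH kM; rewrite card_le_fincard //; last exact: finite_setD.
by rewrite -ltnNge cM.
Qed.

End Drops.

(** * Levels and the relative rank *)

Section Levels.
Context {X : Type} (Xinf : infinite_set [set: X]).
Implicit Types (a : brauer_graph X) (M : set X) (mu : set (set X)).

Lemma cardinal_of_eq M N : (cardinal_of M = cardinal_of N) <-> (M #= N).
Proof.
split=> [e|MN]; first by have : cardinal_of M M := card_eqxx M; rewrite e.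
by apply/seteqP; split=> A; rewrite /cardinal_of /= (card_eqr MN).
Qed.

Lemma card_one_set1 (x : X) : card_one X = cardinal_of [set x].
Proof.
have unitE : [set: unit] = [set tt] by apply/seteqP; split=> // -[].
have E : [set x] #= [set: unit] by rewrite unitE; apply: eq_card1.
by apply/seteqP; split=> A; rewrite /cardinal_of /card_one /= (card_eqr E).
Qed.

Definition levels : set (set (set X)) := card_one X |` infinite_cardinals X.

Lemma level_indecomposable mu :
  levels mu -> exists2 M, indecomposable M & mu = cardinal_of M.
Proof.
have [x0 _] := infinite_setN0 Xinf.
move=> [->|[M /infiniteP Minf <-]]; last by exists M => //; left.
exists [set x0]; last exact: card_one_set1.
by right; split; [exact: finite_set1|exact: fincard_set1].
Qed.

Lemma indecomposable_level M : indecomposable M -> levels (cardinal_of M).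
Proof.
have [x0 _] := infinite_setN0 Xinf.
move=> [Minf|[fM M1]]; first by right; exists M => //; apply/infiniteP.
left; rewrite (card_one_set1 x0); apply/cardinal_of_eq.
by rewrite card_eq_fincard ?fincard_set1 ?M1 //; apply: finite_set1.
Qed.

Lemma dropsP M a : drops M a <->
  card_lt (codef a) (cardinal_of M) /\ cardinal_of M = def a.
Proof.
split=> [[DM nMC]|[[A [B [AC BM AB nBA]]] /cardinal_of_eq MD]].
  split; last by apply/cardinal_of_eq; rewrite card_eq_sym.
  exists (~` Codom a), M; split=> //; try exact: card_eqxx.
  by have [|MC] := card_le_total (~` Codom a) M; last by rewrite MC in nMC.
split; first by rewrite card_eq_sym.
by rewrite -(card_le_eql BM) -(card_le_eqr AC).
Qed.

(** Identifies the cardinal 1 + rho with the set of levels. *)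
Definition level_of (k : unit + infinite_cardinals X) : set (set X) :=
  match k with inl _ => card_one X | inr mu => set_val mu end.

Lemma card_one_notin_infinite : ~ infinite_cardinals X (card_one X).
Proof.
have [x0 _] := infinite_setN0 Xinf.
move=> [M /infiniteP Minf]; rewrite (card_one_set1 x0) => /cardinal_of_eq Mx.
by apply: Minf; rewrite (eq_finite_set Mx); apply: finite_set1.
Qed.

Lemma level_of_inj : injective level_of.
Proof.
move=> [[]|mu] [[]|nu] //= e; last by rewrite (val_inj e).
  by case: card_one_notin_infinite; rewrite e; apply: set_valP.
by case: card_one_notin_infinite; rewrite -e; apply: set_valP.
Qed.

Lemma range_level_of : range level_of = levels.
Proof.
apply/seteqP; split=> mu.
  by move=> [[[]|nu] _ <-]; [left|right; apply: set_valP].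
move=> [->|mui]; first by exists (inl tt).
by exists (inr (SigSub (mem_set mui))).
Qed.

Definition drops_everywhere (U : set (brauer_graph X)) :=
  forall mu, levels mu ->
    exists2 a, U a & card_lt (codef a) mu /\ mu = def a.

Lemma generates_iff (U : set (brauer_graph X)) : U `<=` FL X ->
  FL X = generated (F X `|` U) <-> drops_everywhere U.
Proof.
move=> UFL; split=> [e mu /level_indecomposable[M sM ->]|cU].
  by have [a Ua /dropsP] := drops_necessary Xinf UFL e sM; exists a.
apply/seteqP; split; last exact: generated_FL.
apply: drops_sufficient => // M sM.
by have [a Ua aM] := cU _ (indecomposable_level sM); exists a => //; apply/dropsP.
Qed.

(** The injectivity comes for free, as a drop occurs only at the level given by
    the defect. *)
Lemma choose_drops U : drops_everywhere U ->
  exists f : unit + infinite_cardinals X -> brauer_graph X,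
    injective f /\ forall k, [/\ U (f k), card_lt (codef (f k)) (level_of k) &
      level_of k = def (f k)].
Proof.
move=> cU; have /choice[f fP] : forall k, exists a,
    [/\ U a, card_lt (codef a) (level_of k) & level_of k = def a].
  move=> k; have [|a Ua [al ad]] := cU (level_of k).
    by rewrite -range_level_of; exists k.
  by exists a.
exists f; split=> // k l e; apply: level_of_inj.
by have [_ _ ->] := fP k; have [_ _ ->] := fP l; rewrite e.
Qed.

End Levels.

Theorem theorem7p6 (X : Type) (X_infinite : infinite_set [set: X]) :
  has_relative_rank (FL X) (F X) (one_plus_rho X) /\
  (finite_set (infinite_cardinals X) ->
   forall Omega : set (brauer_graph X),
     Omega `<=` FL X -> Omega #= one_plus_rho X ->
     (FL X = generated (F X `|` Omega) <->
      exists alpha : set (set X) -> brauer_graph X,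
        Omega = [set alpha mu | mu in card_one X |` infinite_cardinals X] /\
        (forall mu, (card_one X |` infinite_cardinals X) mu ->
           card_lt (codef (alpha mu)) mu /\ mu = def (alpha mu)))).
Proof.
split; first split.
- have FLc : drops_everywhere (FL X).
    move=> mu /(level_indecomposable X_infinite)[M sM ->].
    have [g gI gM] := inj_compl_range M X_infinite.
    exists (inj_graph gI); first exact: inj_graph_FL.
    by apply/dropsP; apply: drops_inj_graph.
  have [f [fI fP]] := choose_drops X_infinite FLc.
  have fFL : range f `<=` FL X by move=> _ [k _ <-]; have [] := fP k.
  exists (range f); split=> //; last first.
    by apply: inj_card_eq => k l _ _; apply: fI.
  apply/(generates_iff X_infinite fFL) => mu.
  rewrite -range_level_of => -[k _ <-]; exists (f k); first by exists k.
  by have [] := fP k.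
- move=> U UFL /(generates_iff X_infinite UFL).
  move=> /(choose_drops X_infinite)[f [fI fP]].
  by apply: (@card_le_inj _ _ _ _ f) => [k _|k l _ _ /fI//]; have [] := fP k.
move=> rho_fin Omega OFL Ocard; rewrite (generates_iff X_infinite OFL).
split=> [/(choose_drops X_infinite)[f [fI fP]]|[alpha [-> aP]] mu lmu];
  last by exists (alpha mu); [exists mu|apply: aP].
(* Omega is finite and f injects a set of the same size into it. *)
have fO : range f = Omega.
  apply: finite_sub_card_eq.
  - by move=> _ [k _ <-]; have [] := fP k.
  - rewrite (eq_finite_set Ocard).
    have -> : one_plus_rho X =
        inl @` [set: unit] `|` inr @` [set: infinite_cardinals X].
      apply/seteqP; split=> // -[u|mu] _; first by left; exists u.
      by right; exists mu.
    rewrite finite_setU; split; apply: finite_image; first exact: finite_finset.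
    by rewrite (eq_finite_set (card_setT _)).
  - rewrite (card_le_eql Ocard).
    apply: (@card_le_inj _ _ _ _ f) => [k _|k l _ _ /fI//].
    by exists k.
(* alpha is f read on levels; off the levels its values are arbitrary. *)
have /choice[alpha alphaP] : forall mu, exists a,
    forall k, level_of k = mu -> a = f k.
  move=> mu; have [[k <-]|nk] := pselect (exists k, level_of k = mu).
    by exists (f k) => l /(level_of_inj X_infinite) ->.
  by exists 1 => k kmu; case: nk; exists k.
exists alpha; split.
  rewrite -fO -/(levels) -range_level_of.
  apply/seteqP; split=> [_ [k _ <-]|_ [_ [k _ <-] <-]].
    by exists (level_of k); [exists k|apply: alphaP].
  by exists k => //; rewrite (alphaP _ k).
move=> mu; rewrite -/(levels) -range_level_of => -[k _ <-].
by rewrite (alphaP _ k) //; have [] := fP k.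
Qed.
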